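(* For every positive integer $n$ there is a constant $c_n$ such that for every $A\in\mathbb{C}^{n\times n}$ with $\|A\|\le 1$ and every $\epsilon\in(0,1)$, $$\inf_{E\in\mathbb{C}^{n\times n}}\left(\kappa_V(A+E)\,\epsilon+\|E\|\right)\le c_n\sqrt{\epsilon}.$$
   Context: $\|\cdot\|$ denotes the operator norm (spectral norm) of a matrix. For $M\in\mathbb{C}^{n\times n}$, the eigenvector condition number is $$\kappa_V(M)=\inf_{V:\,M=VDV^{-1}}\|V\|\,\|V^{-1}\|,$$ where the infimum is over all invertible $V\in\mathbb{C}^{n\times n}$ for which $M=VDV^{-1}$ with $D$ diagonal; $\kappa_V(M)=\infty$ if $M$ is not diagonalizable. *)

(* Defs.v *)
From mathcomp Require Import all_boot all_order all_algebra.
From mathcomp Require Import complex.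
From mathcomp Require Import boolp classical_sets reals constructive_ereal ereal.

Set Implicit Arguments.
Unset Strict Implicit.
Unset Printing Implicit Defensive.

Import Order.TTheory GRing.Theory Num.Theory.

Local Open Scope classical_set_scope.
Local Open Scope ring_scope.

(* The norm `|z| of R[i] is itself R[i]-valued; [Normc.normc z : R] is the
   modulus as an element of R. *)
Definition l2norm (R : realType) (n : nat) (x : 'cV[R[i]]_n) : R :=
  Num.sqrt (\sum_(i < n) Normc.normc (x i 0) ^+ 2).

(* The supremum is over a nonempty bounded set, so the default value of [sup]
   never occurs. *)
Definition opnorm (R : realType) (n : nat) (M : 'M[R[i]]_n) : R :=
  sup [set l2norm (M *m x) | x in [set x : 'cV[R[i]]_n | l2norm x <= 1]].

(* ereal_inf set0 = +oo, which is the value for a non-diagonalizable M. *)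
Definition kappaV (R : realType) (n : nat) (M : 'M[R[i]]_n) : \bar R :=
  ereal_inf [set (opnorm V * opnorm (invmx V))%:E | V in
    [set V : 'M[R[i]]_n | V \in unitmx /\
      exists D : 'M[R[i]]_n, is_diag_mx D /\ M = V *m D *m invmx V]].

(* Main.v *)
Require Import Defs.
From mathcomp Require Import all_boot all_order all_algebra.
From mathcomp Require Import ring lra.
From mathcomp Require Import complex.
From mathcomp Require Import boolp classical_sets reals constructive_ereal ereal.
From mathcomp Require Import sequences exp.

(** The perturbation is a maximiser of a potential. For [lam] the (simple)
    eigenvalues of [M], put

      [energy M = sum_i |lam_i|^2 - c |M - A|_F^2 + h sum_(i != j) ln |lam_i - lam_j|]

    with [c] of order [1 / eps] and [h] tiny. Along a complex line [M + t E_kl]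
    the simple eigenvalues are holomorphic in [t], so the logarithmic barrier is
    harmonic and the average of the energy over a small circle of radius [eta]
    exceeds its value at the center by
    [eta^2 (sum_i |d lam_i / d t|^2 - c) + O(eta^3)]. At a maximum all the
    derivatives of eigenvalues in coordinate directions are therefore at most
    [sqrt c]. They are the entries of the spectral projections of [M], which
    bounds the eigenvector condition number by a multiple of [1 / sqrt eps],
    while comparing the maximal energy with its value next to [A] bounds
    [|M - A|_F] by a multiple of [sqrt eps].

    Circles are replaced by the four points [eta * i^k], and the maximum by a
    near maximum: the barrier keeps the eigenvalue gaps of near maxima away from
    [0], so the error terms are uniform and no compactness is needed. *)

Set Implicit Arguments.
Unset Strict Implicit.
Unset Printing Implicit Defensive.

Import Order.TTheory GRing.Theory Num.Theory.
Import Normc.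

Local Open Scope classical_set_scope.
Local Open Scope ring_scope.

(** * Moduli and polynomials over [R[i]] *)

Section Modulus.
Local Open Scope complex_scope.
Variable R : realType.
Implicit Types (w x y z : R[i]) (p q : {poly R[i]}).

Lemma normcD x y : normc (x + y) <= normc x + normc y.
Proof. exact: le_normcD. Qed.

Lemma normc_opp x : normc (- x) = normc x.
Proof. exact: normcN. Qed.

Lemma normcBC x y : normc (x - y) = normc (y - x).
Proof. by rewrite -normc_opp opprB. Qed.

Lemma normcB x y : normc x - normc y <= normc (x - y).
Proof. by rewrite lerBlDr -{1}(subrK y x) normcD. Qed.

Lemma normcB_le x y : normc (x - y) <= normc x + normc y.
Proof. by rewrite -(normc_opp y) normcD. Qed.

Lemma normcDB x y : normc x - normc y <= normc (x + y).
Proof. by rewrite -(normc_opp y) -{2}(opprK y) normcB. Qed.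

Lemma normc_ge0 x : 0 <= normc x.
Proof. by case: x => a b; rewrite sqrtr_ge0. Qed.

Lemma normc_gt0 x : (0 < normc x) = (x != 0).
Proof.
rewrite lt_def normc_ge0 andbT; congr (~~ _).
by apply/eqP/eqP => [/eq0_normc|->]; rewrite ?normc0.
Qed.

Lemma normc_real (a : R) : 0 <= a -> normc a%:C = a.
Proof. by move=> a0; rewrite /= expr0n addr0 sqrtr_sqr ger0_norm. Qed.

Lemma normcX x k : normc (x ^+ k) = normc x ^+ k.
Proof. by elim: k => [|k IH]; rewrite ?normc1 // !exprS normcM IH. Qed.

Lemma normc_sqr x : normc x ^+ 2 = complex.Re x ^+ 2 + complex.Im x ^+ 2.
Proof. by case: x => a b /=; rewrite sqr_sqrtr // addr_ge0 ?sqr_ge0. Qed.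

Lemma normc_sum (I : Type) (r : seq I) (P : pred I) (F : I -> R[i]) :
  normc (\sum_(i <- r | P i) F i) <= \sum_(i <- r | P i) normc (F i).
Proof.
elim/big_rec2: _ => [|i y x _ le]; first by rewrite normc0.
by apply: le_trans (normcD _ _) _; rewrite lerD2l.
Qed.

Lemma normc_prod (I : Type) (r : seq I) (P : pred I) (F : I -> R[i]) :
  normc (\prod_(i <- r | P i) F i) = \prod_(i <- r | P i) normc (F i).
Proof. by apply: (big_morph _ (@normcM R) (normc1 R)). Qed.

(* The logarithmic derivative of the product is a sum of [size rs] terms
   [1 / (w - rho)]. *)
Lemma deriv_prod_XsubC_le (rs : seq R[i]) w (x : R) : 0 <= x ->
  (forall rho, rho \in rs -> x <= normc (w - rho)) ->
  normc ((\prod_(rho <- rs) ('X - rho%:P))^`()).[w] * x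
    <= (size rs)%:R * normc (\prod_(rho <- rs) ('X - rho%:P)).[w].
Proof.
move=> x0; elim: rs => [|r rs IH] H.
  by rewrite !big_nil derivC horner0 normc0 !mul0r.
rewrite !big_cons derivM derivXsubC mul1r !hornerE /= -natr1 [(_ + 1) * _]mulrDl mul1r normcM.
have xr : x <= normc (w - r) by apply: H; rewrite inE eqxx.
have {}IH := IH (fun rho Hr => H rho (mem_behead (s := r :: rs) Hr)).
set p := \prod_(_ <- _) _ in IH *.
apply: le_trans (_ : (normc p.[w] + normc (w - r) * normc p^`().[w]) * x <= _).
  by rewrite ler_wpM2r // (le_trans (normcD _ _)) // normcM.
have := ler_wpM2l (normc_ge0 (w - r)) IH.
have := ler_wpM2l (normc_ge0 p.[w]) xr.
lra.
Qed.

(** Each factor multiplies a bound on the coefficients by at most [1 + B]. *)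
Lemma coef_prod_XsubC_le (rs : seq R[i]) (B : R) k : 0 <= B ->
  (forall rho, rho \in rs -> normc rho <= B) ->
  normc (\prod_(rho <- rs) ('X - rho%:P))`_k <= (1 + B) ^+ size rs.
Proof.
move=> B0; elim: rs k => [|r rs IH] k H.
  by rewrite big_nil coef1 expr0; case: (k == 0%N); rewrite ?normc1 ?normc0.
rewrite big_cons mulrBl coefB coefXM coefCM exprS mulrDl mul1r.
apply: le_trans (normcB_le _ _) _.
have {}IH j := IH j (fun rho Hr => H rho (mem_behead (s := r :: rs) Hr)).
apply: lerD; first by case: ifP => _; rewrite ?normc0 ?exprn_ge0 ?addr_ge0.
by rewrite normcM ler_pM ?normc_ge0 // H // inE eqxx.
Qed.

(* The second-order coefficient [s] is independent of [h], the remainder [r] is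
   not. *)
Lemma taylor2_uniform (m : nat) (K B : R) : exists2 C : R, 1 <= C &
  forall p x, (size p <= m)%N -> (forall k, normc p`_k <= K) -> normc x <= B ->
  exists s : R[i], [/\ normc p.[x] <= C, normc p^`().[x] <= C, normc s <= C &
    forall h, normc h <= 1 -> exists2 r, normc r <= C &
      p.[x + h] = p.[x] + p^`().[x] * h + s * h ^+ 2 + r * h ^+ 3].
Proof.
elim: m => [|m [C C1 IH]].
  exists 1 => // p x; rewrite leqn0 size_poly_eq0 => /eqP -> _ _; exists 0.
  rewrite deriv0 !horner0 normc0; split=> // h _; exists 0; rewrite ?normc0 //.
  by rewrite horner0 !mul0r !addr0.
have C0 : 0 <= C by lra.
exists (C * (1 + `|B|) + C + `|K|) => [|p x].
  have := normr_ge0 B; have := normr_ge0 K; nra.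
elim/poly_ind: p => [|p c _] sp pK xB.
  exists 0; have ? : 0 <= C * (1 + `|B|) + C + `|K|.
    by rewrite !addr_ge0 // mulr_ge0 // addr_ge0.
  rewrite deriv0 !horner0 normc0; split=> // h _; exists 0; rewrite ?normc0 //.
  by rewrite horner0 !mul0r !addr0.
have sp' : (size p <= m)%N.
  have [->|p0] := eqVneq p 0; first by rewrite size_poly0.
  by move: sp; rewrite size_MXaddC (negbTE p0) /= ltnS.
have pK' k : normc p`_k <= K.
  by have := pK k.+1; rewrite coefD coefMX coefC /= addr0.
have cK : normc c <= `|K|.
  have := pK 0%N; rewrite coefD coefMX coefC /= add0r => h.
  exact: le_trans h (ler_norm _).
have xB' : normc x <= `|B| by exact: le_trans xB (ler_norm _).
have [s [H0 H1 H2 H3]] := IH _ _ sp' pK' xB.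
have K0 := normr_ge0 K; have B0 := normr_ge0 B; have nx := normc_ge0 x.
have Mx z : normc z <= C -> normc (z * x) <= C * (1 + `|B|).
  by move=> zC; rewrite normcM ler_pM ?normc_ge0 //; lra.
exists (s * x + p^`().[x]); rewrite derivMXaddC !(hornerD, hornerMX, hornerC).
split.
- by apply: le_trans (normcD _ _) _; have := Mx _ H0; lra.
- by apply: le_trans (normcD _ _) _; have := Mx _ H1; lra.
- by apply: le_trans (normcD _ _) _; have := Mx _ H2; lra.
- move=> h h1; have [r rC E] := H3 h h1.
  exists (r * (x + h) + s); last by rewrite hornerD hornerMX hornerC E; ring.
  apply: le_trans (normcD _ _) _.
  have : normc (r * (x + h)) <= C * (1 + `|B|).
    rewrite normcM ler_pM ?normc_ge0 //; apply: le_trans (normcD _ _) _; lra.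
  lra.
Qed.
End Modulus.

Lemma size_index_ord n : size (index_enum 'I_n) = n.
Proof. by rewrite [index_enum _]unlock -enumT size_enum_ord. Qed.

Lemma deriv_prod_XsubC_root (F : comNzRingType) n (lam : 'I_n -> F) i :
  ((\prod_j ('X - (lam j)%:P))^`()).[lam i] = \prod_(j | j != i) (lam i - lam j).
Proof.
rewrite (bigD1 i) //= derivM derivXsubC mul1r hornerD hornerM hornerXsubC.
by rewrite subrr mul0r addr0 horner_prod; apply: eq_bigr => j _; rewrite hornerXsubC.
Qed.

(** * Uniform second-order expansion of simple roots *)

Section Roots.
Variable R : realType.
Implicit Types (w x y z : R[i]) (p q : {poly R[i]}).

Lemma ler_normcM x y (a b : R) : normc x <= a -> normc y <= b ->
  normc (x * y) <= a * b.
Proof. by move=> xa yb; rewrite normcM ler_pM ?normc_ge0. Qed.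

Lemma size_deriv_le p : (size p^`() <= size p)%N.
Proof. by rewrite /deriv (leq_trans (size_poly _ _)) ?leq_pred. Qed.

Lemma coef_deriv_le m (K : R) p : (size p <= m)%N ->
  (forall k, normc p`_k <= K) -> forall k, normc p^`()`_k <= K * m%:R.
Proof.
move=> sp pK k; rewrite coef_deriv.
have K0 : 0 <= K by exact: le_trans (normc_ge0 _) (pK 0%N).
have [km|mk] := ltnP k.+1 m.
  rewrite normcMn -[_ *+ k.+1]mulr_natr.
  by apply: ler_pM; rewrite ?normc_ge0 ?ler0n // ler_nat ltnW.
by rewrite nth_default ?mul0rn ?normc0 ?mulr_ge0 // (leq_trans sp).
Qed.

Lemma normc_sum6 x1 x2 x3 x4 x5 x6 : normc (x1 + x2 + x3 - x4 - x5 - x6)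
  <= normc x1 + normc x2 + normc x3 + normc x4 + normc x5 + normc x6.
Proof.
have := normcB_le (x1 + x2 + x3 - x4 - x5) x6.
have := normcB_le (x1 + x2 + x3 - x4) x5; have := normcB_le (x1 + x2 + x3) x4.
have := normcD (x1 + x2) x3; have := normcD x1 x2; lra.
Qed.

(** The numbers [a] and [b] make the coefficients of [t] and [t^2] in [(p - t q)(d + a t + b t^2)]
    vanish, so only a cubic residual is left. The lower bound on the derivative later turns this
    approximate root into a nearby exact one. [L] and [e] depend on [m], [K], [B], [g] alone. *)
Lemma newton_expansion (m : nat) (K B g : R) : 0 < g ->
  exists L e : R, [/\ 1 <= L, 0 < e, e <= 1 & forall p q d,
    (size p <= m)%N -> (size q <= m)%N ->
    (forall k, normc p`_k <= K) -> (forall k, normc q`_k <= K) ->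
    normc d <= B -> p.[d] = 0 -> g <= normc p^`().[d] ->
    let a := q.[d] / p^`().[d] in
    exists b, [/\ normc a <= L, normc b <= L & forall t, normc t <= e ->
      let w := d + a * t + b * t ^+ 2 in
      normc (p - t *: q).[w] <= L * normc t ^+ 3 /\
      g / 2 <= normc (p - t *: q)^`().[w]]].
Proof.
move=> g0.
have [C C1 HC] := taylor2_uniform m K B.
have [D D1 HD] := taylor2_uniform m (K * m%:R) B.
(* [L1] dominates both [a] and [b]; [L2] adds up bounds for the six terms of the remainder [X]
   below. *)
pose L1 := C / g + (C * (C / g) + C * (C / g) ^+ 2) / g + 1.
have Cg : 0 <= C / g by rewrite divr_ge0 ?ltW //; lra.
have L1_ge : 0 <= (C * (C / g) + C * (C / g) ^+ 2) / g.
  apply: divr_ge0; last lra.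
  by rewrite addr_ge0 // mulr_ge0 ?exprn_ge0 //; lra.
have L11 : 1 <= L1 by rewrite /L1; lra.
have C0 : 0 <= C := le_trans ler01 C1.
have D0 : 0 <= D := le_trans ler01 D1.
have L10 : 0 <= L1 := le_trans ler01 L11.
pose L2 := 3 * (C * L1 ^+ 2) + 2 * (C * (2 * L1) ^+ 3) + C * L1 + C * (2 * L1) ^+ 2.
have L2_ge : 0 <= L2.
  by rewrite /L2 !addr_ge0 // ?mulr_ge0 // ?exprn_ge0 ?mulr_ge0.
(* The first bound keeps [|c t| <= 1], where the Taylor expansions apply; the second keeps the
   derivative of [p - t q] at [d + c t] within [g / 2] of [p'(d)]. *)
pose e := Num.min (2 * L1)^-1 (g / (20 * D * L1)).
have DL : 0 < 20 * D * L1 by rewrite !mulr_gt0 //; lra.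
have e0 : 0 < e by rewrite /e lt_min invr_gt0 divr_gt0 ?mulr_gt0 //; lra.
have e2 : e * (2 * L1) <= 1.
  rewrite -ler_pdivlMr ?mul1r ?mulr_gt0 //; try lra.
  by rewrite /e ge_min lexx.
have e3 : e * (20 * D * L1) <= g.
  by rewrite -ler_pdivlMr // /e ge_min lexx orbT.
have e1 : e <= 1 by nra.
exists (L1 + L2), e; split=> //; first by lra.
move=> p q d sp sq pK qK dB pd0 pg a.
have [s [_ p1C sC Hp]] := HC p d sp pK dB.
have [u [q0C q1C uC Hq]] := HC q d sq qK dB.
have sp' : (size p^`() <= m)%N by exact: leq_trans (size_deriv_le _) sp.
have sq' : (size q^`() <= m)%N by exact: leq_trans (size_deriv_le _) sq.
have p1n0 : p^`().[d] != 0 by rewrite -normc_gt0 (lt_le_trans g0).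
have inv_le x (z : R) : normc x <= z -> normc (x / p^`().[d]) <= z / g.
  move=> xz; apply: ler_normcM => //.
  by rewrite normcV lef_pV2 // posrE ?normc_gt0.
have aC : normc a <= C / g by apply: inv_le.
pose b := (q^`().[d] * a - s * a ^+ 2) / p^`().[d].
have bC : normc b <= (C * (C / g) + C * (C / g) ^+ 2) / g.
  apply: inv_le; apply: le_trans (normcB_le _ _) _; apply: lerD.
    exact: ler_normcM.
  by apply: ler_normcM => //; rewrite normcX lerXn2r // nnegrE ?normc_ge0.
have aL : normc a <= L1 by rewrite /L1; lra.
have bL : normc b <= L1 by rewrite /L1; lra.
exists b; split; [by rewrite ler_wpDr|by rewrite ler_wpDr|move=> t te w].
have t0 := normc_ge0 t.
pose c := a + b * t.
have cL : normc c <= 2 * L1.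
  apply: le_trans (normcD _ _) _.
  have : normc (b * t) <= L1 * 1 by apply: ler_normcM => //; exact: le_trans te e1.
  lra.
have wE : w = d + c * t by rewrite /w /c; ring.
have hL : normc (c * t) <= 2 * L1 * normc t by apply: ler_normcM.
have h1 : normc (c * t) <= 1.
  by apply: le_trans hL _; nra.
rewrite wE.
split.
  have [r rC rE] := Hp _ h1; have [v vC vE] := Hq _ h1.
  pose X := 2%:R * (s * (a * b)) + s * b ^+ 2 * t + r * c ^+ 3 - q^`().[d] * b
    - u * c ^+ 2 - v * c ^+ 3 * t.
  have -> : (p - t *: q).[d + c * t] = X * t ^+ 3.
    rewrite hornerD hornerN hornerZ rE vE pd0 /X /c /b /a.
    by field.
  rewrite normcM normcX ler_wpM2r ?exprn_ge0 //.
  have le1 : normc t <= 1 := le_trans te e1.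
  have m1 : normc (2%:R * (s * (a * b))) <= 2 * (C * (L1 * L1)).
    apply: ler_normcM; last by apply: ler_normcM => //; apply: ler_normcM.
    by rewrite -[2%:R]/(1 + 1); apply: le_trans (normcD _ _) _; rewrite normc1.
  have m2 : normc (s * b ^+ 2 * t) <= C * L1 ^+ 2 * 1.
    apply: ler_normcM => //; apply: ler_normcM => //.
    by rewrite normcX lerXn2r ?nnegrE ?normc_ge0 ?mulr_ge0.
  have c3 : normc (c ^+ 3) <= (2 * L1) ^+ 3.
    by rewrite normcX lerXn2r ?nnegrE ?normc_ge0 ?mulr_ge0.
  have c2 : normc (c ^+ 2) <= (2 * L1) ^+ 2.
    by rewrite normcX lerXn2r ?nnegrE ?normc_ge0 ?mulr_ge0.
  have m3 : normc (r * c ^+ 3) <= C * (2 * L1) ^+ 3 by apply: ler_normcM.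
  have m4 : normc (q^`().[d] * b) <= C * L1 by apply: ler_normcM.
  have m5 : normc (u * c ^+ 2) <= C * (2 * L1) ^+ 2 by apply: ler_normcM.
  have m6 : normc (v * c ^+ 3 * t) <= C * (2 * L1) ^+ 3 * 1.
    by apply: ler_normcM => //; apply: ler_normcM.
  rewrite /X.
  apply: le_trans (normc_sum6 _ _ _ _ _ _) _.
  by rewrite /L2; lra.
have [s' [_ p2D s'D Hp']] := HD _ d sp' (coef_deriv_le sp pK) dB.
have [u' [q1D q2D u'D Hq']] := HD _ d sq' (coef_deriv_le sq qK) dB.
have [r rD rE] := Hp' _ h1; have [v vD vE] := Hq' _ h1.
set h := c * t in hL h1 rE vE *.
have h0 := normc_ge0 h.
rewrite derivB derivZ hornerD hornerN hornerZ.
have hX k : normc (h ^+ k) <= 1 by rewrite normcX exprn_ile1.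
have pd : normc (p^`().[d + h] - p^`().[d]) <= 3 * D * normc h.
  have -> : p^`().[d + h] - p^`().[d] = (p^`()^`().[d] + s' * h + r * h ^+ 2) * h.
    by rewrite rE; ring.
  apply: ler_normcM => //; apply: le_trans (normcD _ _) _.
  have : normc (s' * h) <= D * 1 by apply: ler_normcM.
  have : normc (r * h ^+ 2) <= D * 1 by apply: ler_normcM.
  have := normcD (p^`()^`().[d]) (s' * h).
  lra.
have qd : normc (q^`().[d + h]) <= 4 * D.
  rewrite vE; apply: le_trans (normcD _ _) _.
  have : normc (q^`()^`().[d] * h) <= D * 1 by apply: ler_normcM.
  have : normc (u' * h ^+ 2) <= D * 1 by apply: ler_normcM.
  have : normc (v * h ^+ 3) <= D * 1 by apply: ler_normcM.
  have := normcD (q^`().[d]) (q^`()^`().[d] * h).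
  have := normcD (q^`().[d] + q^`()^`().[d] * h) (u' * h ^+ 2).
  lra.
have tq : normc (t * q^`().[d + h]) <= normc t * (4 * D) by apply: ler_normcM.
apply: le_trans (normcB _ _).
have := normcDB (p^`().[d]) (p^`().[d + h] - p^`().[d]).
rewrite [_ + (_ - _)]addrC subrK.
have : 3 * D * normc h <= 3 * D * (2 * L1 * normc t) by rewrite ler_wpM2l ?mulr_ge0.
have : normc t * (4 * D) <= normc t * (4 * D * L1).
  by rewrite ler_wpM2l // ler_peMr // mulr_ge0.
have : normc t * (20 * D * L1) <= g.
  by apply: le_trans e3; rewrite ler_wpM2r // ltW.
lra.
Qed.

Lemma monic_prod_roots p : p \is monic ->
  exists2 rs : seq R[i], p = \prod_(x <- rs) ('X - x%:P) & size p = (size rs).+1.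
Proof.
move=> /monicP pm; have [rs E] := closed_field_poly_normal p.
exists rs; first by rewrite [LHS]E pm scale1r.
by rewrite E pm scale1r size_prod_XsubC.
Qed.

(** If every root were farther from [w] than the stated radius, the logarithmic derivative at [w]
    would be smaller than [g / y]. The factor 2 makes the contradiction strict. *)
Lemma root_near p w (g y : R) : p \is monic -> 0 < g -> 0 < y ->
  g <= normc p^`().[w] -> normc p.[w] <= y ->
  exists2 z, root p z & normc (z - w) <= 2 * (size p)%:R / g * y.
Proof.
move=> pm g0 y0 gw yw; have [rs pE sE] := monic_prod_roots pm.
have s0 : 0 < (size p)%:R :> R by rewrite sE ltr0n.
have x0 : 0 < 2 * (size p)%:R / g * y by rewrite !mulr_gt0 ?invr_gt0.
set x := 2 * _ / g * y in x0 *.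
apply: contrapT => H.
have : normc p^`().[w] * x <= (size rs)%:R * normc p.[w].
  rewrite [in X in X <= _]pE [in X in _ <= X]pE.
  apply: deriv_prod_XsubC_le => [|rho rin]; first exact: ltW.
  rewrite leNgt; apply/negP => lt; apply: H; exists rho.
    by rewrite pE root_prod_XsubC.
  by rewrite normcBC ltW.
apply/negP; rewrite -ltNge.
apply: le_lt_trans (_ : (size p)%:R * y < _).
  by apply: ler_pM; rewrite ?normc_ge0 ?ler0n // ler_nat sE.
apply: lt_le_trans (_ : g * x <= _); last by rewrite ler_pM2r.
rewrite /x mulrA mulrCA divff ?gt_eqF // mulr1 -mulrA.
by rewrite ltr_pMl ?mulr_gt0 // ltr1n.
Qed.

(** The gap bounds [p'] at each root below by [g^(n-1)], so the Newton expansion and [root_near]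
    give a root of [p - t q] close to each [lam i]. For small [t] these roots are distinct, hence
    they are all the roots. *)
Lemma roots_expansion (n : nat) (B K g : R) : 0 <= B -> 0 < g ->
  exists L e : R, [/\ 1 <= L, 0 < e, e <= 1 & forall (lam : 'I_n -> R[i]) q,
    (size q <= n)%N -> (forall k, normc q`_k <= K) ->
    (forall i, normc (lam i) <= B) ->
    (forall i j, i != j -> g <= normc (lam i - lam j)) ->
    let p := \prod_i ('X - (lam i)%:P) in
    let a i := q.[lam i] / p^`().[lam i] in
    exists b : 'I_n -> R[i], [/\ forall i, normc (a i) <= L,
      forall i, normc (b i) <= L & forall t, 0 < normc t <= e ->
      exists mu : 'I_n -> R[i], [/\ injective mu,
        p - t *: q = \prod_i ('X - (mu i)%:P) & forall i,
        normc (mu i - (lam i + a i * t + b i * t ^+ 2)) <= L * normc t ^+ 3]]].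
Proof.
move=> B0 g0.
have g'0 : 0 < g ^+ n.-1 by rewrite exprn_gt0.
have [L [e [L1 e0 e1 H]]] := newton_expansion n.+1 (`|K| + (1 + B) ^+ n) B g'0.
set g' := g ^+ n.-1 in g'0 H.
pose L' := 2 * n.+1%:R / (g' / 2) * L + L.
have cc : 0 < 2 * n.+1%:R / (g' / 2) :> R by rewrite !mulr_gt0 ?invr_gt0 ?mulr_gt0.
have L'1 : 1 <= L' by have := mulr_gt0 cc (lt_le_trans ltr01 L1); rewrite /L'; lra.
(* Each [mu i] moves by at most [3 L' |t| <= 3 g / 8], less than half a gap, which makes [mu]
   injective. *)
pose e' := Num.min e (g / (8 * L')).
have L'0 : 0 < 8 * L' by lra.
have e'0 : 0 < e' by rewrite /e' lt_min e0 divr_gt0.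
have e'e : e' <= e by rewrite /e' ge_min lexx.
have e'g : e' * (8 * L') <= g by rewrite -ler_pdivlMr // /e' ge_min lexx orbT.
exists L', e'; split=> //; first exact: le_trans e1.
move=> lam q sq qK lamB gap p a.
have pm : p \is monic by exact: monic_prod_XsubC.
have sp : size p = n.+1 by rewrite size_prod_XsubC size_index_ord.
have LL' : L <= L' by rewrite /L' lerDr mulr_ge0 ?ltW // (lt_le_trans ltr01).
have loc i := H p q (lam i).
have pi0 i : p.[lam i] = 0.
  by rewrite horner_prod (bigD1 i) //= hornerXsubC subrr mul0r.
have p'g i : g' <= normc p^`().[lam i].
  rewrite deriv_prod_XsubC_root normc_prod.
  apply: le_trans (_ : \prod_(j | j != i) g <= _).
    by rewrite prodr_const cardC1 card_ord.
  by apply: ler_prod => j ji; rewrite ltW //= gap // eq_sym.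
have pK k : normc p`_k <= `|K| + (1 + B) ^+ n.
  rewrite /p -(big_map lam xpredT (fun z => 'X - z%:P)).
  apply: le_trans (coef_prod_XsubC_le _ B0 _) _.
    by move=> rho /mapP[i _ ->].
  by rewrite size_map size_index_ord lerDr.
have qK' k : normc q`_k <= `|K| + (1 + B) ^+ n.
  apply: le_trans (qK k) _; apply: le_trans (ler_norm _) _.
  by rewrite lerDl exprn_ge0 // addr_ge0.
have {}loc i : exists b, [/\ normc (a i) <= L, normc b <= L & forall t, normc t <= e ->
      let w := lam i + a i * t + b * t ^+ 2 in
      normc (p - t *: q).[w] <= L * normc t ^+ 3 /\
      g' / 2 <= normc (p - t *: q)^`().[w]].
  by apply: loc => //; rewrite ?sp // (leq_trans sq).
have [b Hb] := fin_all_exists loc.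
exists b; split=> [i|i|t /andP[t0 te']].
- by case: (Hb i) => + _ _; lra.
- by case: (Hb i) => _ + _; lra.
have stq : (size (t *: q) <= n)%N by rewrite (leq_trans (size_scale_leq _ _)).
have spt : size (p - t *: q) = n.+1 by rewrite size_polyDl ?size_polyN sp.
have pmt : p - t *: q \is monic.
  by rewrite monicE lead_coefDl ?size_polyN ?sp // -monicE.
have near i : exists z, root (p - t *: q) z /\
    normc (z - (lam i + a i * t + b i * t ^+ 2)) <= (L' - L) * normc t ^+ 3.
  have [_ _ /(_ t (le_trans te' e'e)) [h1 h2]] := Hb i.
  have [||z rz zw] := root_near pmt _ _ h2 h1.
  - by rewrite divr_gt0.
  - by rewrite mulr_gt0 ?exprn_gt0 // (lt_le_trans ltr01).
  by exists z; split=> //; rewrite /L' addrK -[_ * L * _]mulrA -spt.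
have [mu Hmu] := fin_all_exists near.
have mulam i : normc (mu i - lam i) <= 3 * L' * normc t.
  have [a1 b1 _] := Hb i; have [_ m1] := Hmu i.
  have t1 : normc t <= 1 by lra.
  have -> : mu i - lam i = mu i - (lam i + a i * t + b i * t ^+ 2)
     + (a i * t + b i * t * t) by ring.
  apply: le_trans (normcD _ _) _.
  have : normc (a i * t) <= L' * normc t by apply: ler_normcM; lra.
  have : normc (b i * t * t) <= L' * 1 * normc t.
    by apply: ler_normcM => //; apply: ler_normcM; lra.
  have := normcD (a i * t) (b i * t * t).
  have : (L' - L) * normc t ^+ 3 <= L' * normc t.
    apply: ler_pM; rewrite ?subr_ge0 ?exprn_ge0 ?normc_ge0 //; first lra.
    by rewrite -[leRHS]expr1 ler_wiXn2l ?normc_ge0.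
  lra.
have muinj : injective mu.
  move=> i j eij; apply: contrapT => /eqP ij.
  have := gap i j ij.
  have -> : lam i - lam j = (mu j - lam j) - (mu i - lam i) by rewrite eij; ring.
  have := normcB_le (mu j - lam j) (mu i - lam i).
  have := mulam i; have := mulam j.
  have : normc t * (8 * L') <= g by apply: le_trans e'g; rewrite ler_wpM2r // ltW.
  have : 0 < L' * normc t by rewrite mulr_gt0 //; lra.
  lra.
exists mu; split=> // [|i]; last first.
  have [_ m1] := Hmu i; apply: le_trans m1 _.
  by rewrite ler_wpM2r ?exprn_ge0 ?normc_ge0 //; lra.
rewrite -(big_map mu xpredT (fun z => 'X - z%:P)).
(* A monic polynomial of degree [n] is determined by [n] distinct roots. *)
rewrite [LHS](@all_roots_prod_XsubC _ _ [seq mu i | i <- index_enum 'I_n]).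
- by rewrite (monicP pmt) scale1r.
- by rewrite spt size_map size_index_ord.
- by apply/allP => z /mapP[i _ ->]; case: (Hmu i).
by rewrite uniq_rootsE map_inj_uniq // index_enum_uniq.
Qed.
End Roots.

(** * Averages over four points of a circle *)

Section Averages.
Local Open Scope complex_scope.
Variable R : realType.
Implicit Types (x y z a b d : R[i]) (eta : R).

(** The powers [t], [t^2] and [t^3] sum to zero over these four points, so they average low-order
    terms exactly as the whole circle does. *)
Definition cross eta (k : 'I_4) : R[i] := 'i%C ^+ k * eta%:C.

Lemma normc_cross eta k : 0 <= eta -> normc (cross eta k) = eta.
Proof.
by move=> e0; rewrite normcM normcX normc_real //= expr0n add0r expr1n sqrtr1 expr1n mul1r.
Qed.

Lemma normc_parallelogram x y : normc (x + y) ^+ 2 + normc (x - y) ^+ 2 =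
  2 * (normc x ^+ 2 + normc y ^+ 2).
Proof. by case: x y => x1 x2 [y1 y2]; rewrite !normc_sqr /=; ring. Qed.

(** The parallelogram law applies to the two pairs of opposite points, and then once more to
    [d + b eta^2] and [d - b eta^2]. *)
Lemma sum_cross_normc_sqr d a b eta :
  \sum_k normc (d + a * cross eta k + b * cross eta k ^+ 2) ^+ 2 =
  4 * (normc d ^+ 2 + eta ^+ 2 * normc a ^+ 2 + eta ^+ 4 * normc b ^+ 2).
Proof.
rewrite !big_ord_recl big_ord0 /cross /= addr0 /bump /= !add1n expr0 mul1r expr1.
have i2 : 'i%C ^+ 2 = -1 :> R[i] := sqr_i R.
have i1 : normc ('i%C : R[i]) = 1 by rewrite /= expr0n add0r expr1n sqrtr1.
have ie : normc eta%:C ^+ 2 = eta ^+ 2 by rewrite normc_sqr /= expr0n addr0.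
set i := 'i%C in i1 i2 *; set e := eta%:C in ie *.
have -> : d + a * (i * e) + b * (i * e) ^+ 2 = d - b * e ^+ 2 + a * (i * e).
  by rewrite exprMn i2; ring.
have -> : d + a * (i ^+ 2 * e) + b * (i ^+ 2 * e) ^+ 2 = d + b * e ^+ 2 - a * e.
  by rewrite i2; ring.
have -> : d + a * (i ^+ 3 * e) + b * (i ^+ 3 * e) ^+ 2 = d - b * e ^+ 2 - a * (i * e).
  by rewrite exprS i2 exprMn exprMn i2; ring.
have -> : d + a * e + b * e ^+ 2 = d + b * e ^+ 2 + a * e by ring.
have h1 := normc_parallelogram (d + b * e ^+ 2) (a * e).
have h2 := normc_parallelogram (d - b * e ^+ 2) (a * (i * e)).
have h3 := normc_parallelogram d (b * e ^+ 2).
have h4 : normc (b * e ^+ 2) ^+ 2 = normc b ^+ 2 * eta ^+ 4.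
  by rewrite normcM normcX exprMn ie -exprM.
have h5 : normc (a * e) ^+ 2 = normc a ^+ 2 * eta ^+ 2 by rewrite normcM exprMn ie.
have h6 : normc (a * (i * e)) ^+ 2 = normc a ^+ 2 * eta ^+ 2.
  by rewrite normcM normcM i1 mul1r exprMn ie.
lra.
Qed.

(** Discrete form of the harmonicity of the logarithm of the modulus: the product is invariant under
    [eta -> i eta], so only powers of [eta^4] survive. *)
Lemma prod_cross (u v : R[i]) eta : \prod_k (1 + u * cross eta k + v * cross eta k ^+ 2) =
  1 + (4%:R * (u * u * v) - 2%:R * (v * v) - u ^+ 4 + v ^+ 4 * eta%:C ^+ 4) * eta%:C ^+ 4.
Proof.
rewrite !big_ord_recl big_ord0 /cross /= mulr1.
have i2 : 'i%C * 'i%C = -1 :> R[i] by rewrite -expr2 sqr_i.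
set i := 'i%C in i2 *; set e := eta%:C.
have i2' : i ^+ 2 = -1 by rewrite expr2.
have i3 : i ^+ 3 = - i by rewrite !exprS expr0 mulr1 i2; ring.
rewrite /bump /= !add1n expr0 expr1 i3 [i ^+ 2]i2'; ring: i2.
Qed.

(** This is [ln (1 + z) <= z] at [z = y / (x - y)], together with [x - y >= x / 2]. *)
Lemma ln_subl (x y : R) : 0 < x -> 0 <= y -> y <= x / 2 -> ln x - 2 * y / x <= ln (x - y).
Proof.
move=> x0 y0 yx; have xy0 : 0 < x - y by lra.
have -> : ln (x - y) = ln x - ln (x / (x - y)).
  by rewrite ln_div ?posrE //; ring.
rewrite lerD2l lerN2.
have -> : x / (x - y) = 1 + y / (x - y) by field; lra.
apply: le_trans (le_ln1Dx _) _; first by have := divr_ge0 y0 (ltW xy0); lra.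
rewrite ler_pdivrMr // mulrAC ler_pdivlMr //; nra.
Qed.

Lemma sum_cross_normc_sqr_ge (L B : R) : 0 <= L -> 0 <= B ->
  exists C : R, forall d a b (eta : R) (f : 'I_4 -> R[i]),
  normc d <= B -> normc a <= L -> normc b <= L -> 0 < eta <= 1 ->
  (forall k, normc (f k - (d + a * cross eta k + b * cross eta k ^+ 2)) <= L * eta ^+ 3) ->
  4 * (normc d ^+ 2 + eta ^+ 2 * normc a ^+ 2) - C * eta ^+ 3 <= \sum_k normc (f k) ^+ 2.
Proof.
move=> L0 B0; exists (8 * (B + L + L) * L) => d a b eta f dB aL bL /andP[e0 e1] H.
pose y k := d + a * cross eta k + b * cross eta k ^+ 2.
have yB k : normc (y k) <= B + L + L.
  apply: le_trans (normcD _ _) _.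
  have : normc (a * cross eta k) <= L * 1.
    by apply: ler_normcM => //; rewrite normc_cross // ltW.
  have : normc (b * cross eta k ^+ 2) <= L * 1.
    by apply: ler_normcM => //; rewrite normcX exprn_ile1 ?normc_ge0 // normc_cross // ltW.
  have := normcD d (a * cross eta k); lra.
have e3 : 0 <= eta ^+ 3 by rewrite exprn_ge0 // ltW.
(* Dropping the square [(Y - F)^2] gives [F^2 >= Y^2 - 2 Y (Y - F)], so no upper bound on [F] is
   needed. *)
have st k : normc (y k) ^+ 2 - 2 * (B + L + L) * (L * eta ^+ 3) <= normc (f k) ^+ 2.
  have h := H k; have := normcDB (y k) (f k - y k).
  rewrite [_ + (_ - _)]addrC subrK => h2.
  have := normc_ge0 (f k); have := normc_ge0 (y k); have := yB k.
  set F := normc (f k) in h2 *; set Y := normc (y k) in h2 *.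
  have {}h2 : Y - F <= L * eta ^+ 3 by move: h; rewrite -/(y k); lra.
  have D0 : 0 <= L * eta ^+ 3 by rewrite mulr_ge0.
  set D := L * eta ^+ 3 in D0 h2 *.
  move=> Y1 Y0 F0.
  have : Y * (Y - F) <= Y * D by rewrite ler_wpM2l.
  have : Y * D <= (B + L + L) * D by rewrite ler_wpM2r.
  have : 0 <= (Y - F) ^+ 2 by rewrite sqr_ge0.
  nra.
apply: le_trans (_ : \sum_k (normc (y k) ^+ 2 - 2 * (B + L + L) * (L * eta ^+ 3)) <= _).
  rewrite sumrB sum_cross_normc_sqr sumr_const card_ord -mulr_natr.
  have : 0 <= eta ^+ 4 * normc b ^+ 2 by rewrite mulr_ge0 ?exprn_ge0 ?normc_ge0 // ltW.
  lra.
by apply: ler_sum.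
Qed.
Lemma ln_prod (I : finType) (F : I -> R) : (forall k, 0 < F k) ->
  ln (\prod_k F k) = \sum_k ln (F k).
Proof.
move=> F0; suff [] : 0 < \prod_k F k /\ ln (\prod_k F k) = \sum_k ln (F k) by [].
elim/big_rec2: _ => [|k x y _ [y0 e]]; first by rewrite ltr01 ln1.
by rewrite mulr_gt0 // lnM ?posrE // e.
Qed.

(* The four values of [1 + u t + v t^2] multiply to [1 + O(eta^4)]: only the
   perturbation of [f] contributes a cubic error. *)
Lemma sum_cross_ln_ge1 (L : R) : 0 <= L ->
  exists C e : R, [/\ 0 < e, e <= 1 & forall u v (eta : R) (f : 'I_4 -> R[i]),
  normc u <= L -> normc v <= L -> 0 < eta <= e ->
  (forall k, normc (f k - (1 + u * cross eta k + v * cross eta k ^+ 2)) <= L * eta ^+ 3) ->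
  (forall k, f k != 0) /\ - C * eta ^+ 3 <= \sum_k ln (normc (f k))].
Proof.
move=> L0; pose M := 1 + L.
have M1 : 1 <= M by rewrite /M; lra.
have LM : L <= M by rewrite /M; lra.
have M4 : 1 <= M ^+ 4 by rewrite exprn_ege1.
(* Half of [32 M^4] pays for replacing [f] by [y] at four points, half for the [eta^4] term of the
   product. The radius keeps [|y k| >= 1/2] and the deviation of the product from 1 at most
   [1/2]. *)
exists (32 * M ^+ 4), (16 * M ^+ 4)^-1; split.
- by rewrite invr_gt0; lra.
- by rewrite invf_le1; lra.
move=> u v eta f uL vL /andP[e0 ee] H.
have eM : eta * (16 * M ^+ 4) <= 1 by rewrite -ler_pdivlMr ?mul1r //; lra.
have e1 : eta <= 1 by nra.
have ML : M <= M ^+ 4 by rewrite -[leLHS]expr1 ler_weXn2l.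
have eL : eta * (16 * L) <= 1.
  apply: le_trans eM; apply: ler_wpM2l; first exact: ltW.
  lra.
have e2 : 0 <= eta ^+ 2 <= eta.
  by rewrite exprn_ge0 ?(ltW e0) //= expr2 ler_piMl // (ltW e0).
have e3 : 0 <= eta ^+ 3 <= eta.
  rewrite exprn_ge0 ?(ltW e0) //= exprS ler_piMr ?(ltW e0) //.
  by case/andP: e2 => _ h; lra.
pose y k := 1 + u * cross eta k + v * cross eta k ^+ 2.
have tk k : normc (cross eta k) = eta by rewrite normc_cross // ltW.
have y2 k : 2^-1 <= normc (y k).
  have : normc (u * cross eta k) <= L * eta by apply: ler_normcM; rewrite ?tk.
  have : normc (v * cross eta k ^+ 2) <= L * eta.
    by apply: ler_normcM => //; rewrite normcX tk; case/andP: e2.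
  have := normcDB (1 + u * cross eta k) (v * cross eta k ^+ 2).
  have := normcDB 1 (u * cross eta k); rewrite normc1 /y; lra.
have L3 : L * eta ^+ 3 <= 8^-1.
  have : L * eta ^+ 3 <= L * eta by rewrite ler_wpM2l //; case/andP: e3.
  lra.
have L30 : 0 <= L * eta ^+ 3 by rewrite mulr_ge0 //; case/andP: e3.
have fy k : normc (y k) - L * eta ^+ 3 <= normc (f k).
  have h := H k; have := normcDB (y k) (f k - y k).
  rewrite [_ + (_ - _)]addrC subrK; rewrite -/(y k) in h; lra.
split=> [k|]; first by rewrite -normc_gt0; have := fy k; have := y2 k; lra.
have Xle : normc (4%:R * (u * u * v) - 2%:R * (v * v) - u ^+ 4 + v ^+ 4 * eta%:C ^+ 4)
    <= 8 * M ^+ 4.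
  have nat_le j : normc (j%:R : R[i]) = j%:R by rewrite normcMn normc1.
  have uM : normc u <= M by lra.
  have vM : normc v <= M by lra.
  have X4 z : normc z <= M -> normc (z ^+ 4) <= M ^+ 4.
    by move=> zM; rewrite normcX lerXn2r ?nnegrE ?normc_ge0 //; lra.
  have e4 : normc (eta%:C ^+ 4) <= 1.
    by rewrite normcX normc_real ?exprn_ile1 // ltW.
  have : normc (4%:R * (u * u * v)) <= 4 * (M * M * M).
    by apply: ler_normcM; rewrite ?nat_le //; do 2! apply: ler_normcM => //.
  have : normc (2%:R * (v * v)) <= 2 * (M * M).
    by apply: ler_normcM; rewrite ?nat_le //; apply: ler_normcM.
  have := X4 u uM.
  have : normc (v ^+ 4 * eta%:C ^+ 4) <= M ^+ 4 * 1 by apply: ler_normcM => //; apply: X4.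
  have h3 : M * M * M <= M ^+ 4.
    by rewrite (_ : M * M * M = M ^+ 3) ?ler_weXn2l //; ring.
  have h2 : M * M <= M ^+ 4 by rewrite (_ : M * M = M ^+ 2) ?ler_weXn2l //; ring.
  have := normcD (4%:R * (u * u * v) - 2%:R * (v * v) - u ^+ 4) (v ^+ 4 * eta%:C ^+ 4).
  have := normcB_le (4%:R * (u * u * v) - 2%:R * (v * v)) (u ^+ 4).
  have := normcB_le (4%:R * (u * u * v)) (2%:R * (v * v)).
  lra.
have e4 : eta ^+ 4 <= eta ^+ 3 by rewrite ler_wiXn2l // ltW.
have e4' : 0 <= eta ^+ 4 by rewrite exprn_ge0 // ltW.
have py : 1 - 8 * M ^+ 4 * eta ^+ 4 <= \prod_k normc (y k).
  rewrite -normc_prod prod_cross; apply: le_trans (normcDB _ _); rewrite normc1.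
  by rewrite lerD2l lerN2; apply: ler_normcM; rewrite // normcX normc_real // ltW.
have x2 : 8 * M ^+ 4 * eta ^+ 4 <= 1 / 2.
  have : 16 * M ^+ 4 * eta ^+ 4 <= 16 * M ^+ 4 * eta.
    apply: ler_wpM2l; first lra.
    by case/andP: e3 => _; apply: le_trans.
  lra.
have lnfy k : ln (normc (y k)) - 4 * (L * eta ^+ 3) <= ln (normc (f k)).
  have yk0 : 0 < normc (y k) by have := y2 k; lra.
  apply: le_trans (_ : ln (normc (y k) - L * eta ^+ 3) <= _); last first.
    by rewrite ler_ln ?posrE //; have := fy k; have := y2 k; lra.
  apply: le_trans (ln_subl _ _ _) => //; last by have := y2 k; lra.
  rewrite lerD2l lerN2 ler_pdivrMr //; have := y2 k; nra.
apply: le_trans (_ : \sum_k (ln (normc (y k)) - 4 * (L * eta ^+ 3)) <= _); last exact: ler_sum.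
rewrite sumrB -ln_prod => [|k]; last by have := y2 k; lra.
rewrite sumr_const card_ord -mulr_natr.
have : ln 1 - 2 * (8 * M ^+ 4 * eta ^+ 4) / 1 <= ln (\prod_k normc (y k)).
  have x0 : 0 <= 8 * M ^+ 4 * eta ^+ 4.
    by apply: mulr_ge0 => //; apply: mulr_ge0 => //; exact: le_trans M4.
  apply: le_trans (ln_subl _ x0 x2) _ => //.
  by rewrite ler_ln ?posrE //; lra.
rewrite ln1 divr1.
have : M ^+ 4 * eta ^+ 4 <= M ^+ 4 * eta ^+ 3 by rewrite ler_wpM2l //; lra.
have : L * eta ^+ 3 <= M ^+ 4 * eta ^+ 3 by rewrite ler_wpM2r //; [case/andP: e3|lra].
lra.
Qed.

Lemma sum_cross_ln_ge (L g : R) : 0 <= L -> 0 < g ->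
  exists C e : R, [/\ 0 < e, e <= 1 & forall w u v (eta : R) (f : 'I_4 -> R[i]),
  g <= normc w -> normc u <= L -> normc v <= L -> 0 < eta <= e ->
  (forall k, normc (f k - (w + u * cross eta k + v * cross eta k ^+ 2)) <= L * eta ^+ 3) ->
  4 * ln (normc w) - C * eta ^+ 3 <= \sum_k ln (normc (f k))].
Proof.
move=> L0 g0; have [|C [e [e0 e1 H]]] := @sum_cross_ln_ge1 (L / g).
  by rewrite divr_ge0 // ltW.
exists C, e; split=> // w u v eta f gw uL vL ee fH.
have w0 : 0 < normc w by exact: lt_le_trans gw.
have wn0 : w != 0 by rewrite -normc_gt0.
have div z (x : R) : normc z <= x -> normc (z / w) <= x / g.
  by move=> zx; apply: ler_normcM => //; rewrite normcV lef_pV2 // posrE.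
have [|||k|fn0] := H (u / w) (v / w) eta (fun k => f k / w); try exact: div; first by [].
  rewrite [L / g * _]mulrAC.
  have -> : f k / w - (1 + u / w * cross eta k + v / w * cross eta k ^+ 2) =
     (f k - (w + u * cross eta k + v * cross eta k ^+ 2)) / w by field.
  exact: div.
have fk0 k : 0 < normc (f k).
  by rewrite normc_gt0; apply: contra (fn0 k) => /eqP ->; rewrite mul0r.
have -> : \sum_k ln (normc (f k / w)) = \sum_k ln (normc (f k)) - 4 * ln (normc w).
  rewrite (eq_bigr (fun k => ln (normc (f k)) - ln (normc w))) => [|k _].
    by rewrite sumrB sumr_const card_ord mulr_natl.
  by rewrite normcM normcV ln_div ?posrE.
lra.
Qed.
End Averages.

(** * Characteristic polynomials *)

Section CharPoly.
Variables (F : fieldType) (n : nat).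
Implicit Types (M V : 'M[F]_n).

(** Expansion along row [k]: its cofactors do not see the changed entry. The characteristic
    polynomial is thus affine in [t], of the form [p - t q] treated by [roots_expansion]. *)
Lemma char_poly_add_delta M (t : F) k l :
  char_poly (M + t *: delta_mx k l) =
  char_poly M - t *: cofactor (char_poly_mx M) k l.
Proof.
rewrite /char_poly (expand_det_row _ k) (expand_det_row (char_poly_mx M) k).
have cofE j : cofactor (char_poly_mx (M + t *: delta_mx k l)) k j =
    cofactor (char_poly_mx M) k j.
  rewrite /cofactor; congr (_ * \det _); apply/matrixP=> a b.
  by rewrite !mxE [lift k a == k]eq_sym (negbTE (neq_lift _ _)) /= mulr0 addr0.
rewrite (bigD1 l) //= [in RHS](bigD1 l) //= !cofE.
under eq_bigr => j jl.
  rewrite cofE (_ : char_poly_mx (M + t *: delta_mx k l) k j = char_poly_mx M k j);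
    last by rewrite !mxE (negbTE jl) andbF mulr0 addr0.
  over.
rewrite addrAC; congr (_ + _).
by rewrite !mxE !eqxx mulr1 polyCD opprD addrA mulrBl mul_polyC.
Qed.

Lemma char_poly_conj M V : V \in unitmx -> char_poly (invmx V *m M *m V) = char_poly M.
Proof.
move=> uV; rewrite /char_poly /char_poly_mx !map_mxM.
have mV : map_mx polyC (invmx V) *m map_mx polyC V = 1%:M.
  by rewrite -map_mxM mulVmx // map_mx1.
have -> : 'X%:M - map_mx polyC (invmx V) *m map_mx polyC M *m map_mx polyC V
    = map_mx polyC (invmx V) *m ('X%:M - map_mx polyC M) *m map_mx polyC V.
  rewrite mulmxBr mulmxBl; congr (_ - _).
  by rewrite mul_mx_scalar -scalemxAl mV scalemx1.
by rewrite !det_mulmx mulrAC -det_mulmx mV det1 mul1r.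
Qed.

Lemma char_poly_diag (d : 'I_n -> F) :
  char_poly (diag_mx (\row_i d i)) = \prod_i ('X - (d i)%:P).
Proof.
rewrite char_poly_trig; last exact: diag_mx_is_trig.
by apply: eq_bigr => i _; rewrite !mxE eqxx mulr1n.
Qed.

(* The adjugate is determined by [X *m \adj X = (\det X)%:M], because the
   determinant of [X] is a nonzero polynomial. *)
Lemma cofactor_char_poly_diag V (d : 'I_n -> F) k l : V \in unitmx ->
  cofactor (char_poly_mx (invmx V *m diag_mx (\row_i d i) *m V)) k l =
  \sum_i (invmx V l i * V i k) *: \prod_(j | j != i) ('X - (d j)%:P).
Proof.
move=> uV; set M := _ *m V; set X := char_poly_mx M.
pose p := \prod_i ('X - (d i)%:P).
pose r := \row_i \prod_(j | j != i) ('X - (d j)%:P).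
pose W := map_mx polyC V; pose W' := map_mx polyC (invmx V).
have mV : W' *m W = 1%:M by rewrite -map_mxM mulVmx // map_mx1.
have mV' : W *m W' = 1%:M by rewrite -map_mxM mulmxV // map_mx1.
have detX : \det X = p by rewrite /p -char_poly_diag -(char_poly_conj _ uV).
have XE : X = W' *m diag_mx (\row_i ('X - (d i)%:P)) *m W.
  have -> : diag_mx (\row_i ('X - (d i)%:P)) = 'X%:M - map_mx polyC (diag_mx (\row_i d i)).
    apply/matrixP=> i j; rewrite !mxE; case: (i == j) => //=.
    by rewrite !mulr0n polyC0 subr0.
  rewrite mulmxBr mulmxBl mul_mx_scalar -scalemxAl mV scalemx1.
  by rewrite /X /char_poly_mx /M !map_mxM.
have XC : X *m (W' *m diag_mx r *m W) = p%:M.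
  rewrite XE !mulmxA -[_ *m W *m W']mulmxA mV' mulmx1 -[_ *m diag_mx _ *m diag_mx r]mulmxA.
  have -> : diag_mx (\row_i ('X - (d i)%:P)) *m diag_mx r = p%:M.
    rewrite mulmx_diag; apply/matrixP=> i j; rewrite !mxE; case: eqP => [_|_] //.
    by rewrite /p [in RHS](bigD1 i).
  by rewrite mul_mx_scalar -scalemxAl mV scalemx1.
have adjE : \adj X = W' *m diag_mx r *m W.
  have p0 : p != 0 by rewrite monic_neq0 // monic_prod_XsubC.
  have /matrixP E : p *: \adj X = p *: (W' *m diag_mx r *m W).
    by rewrite -mul_mx_scalar -XC mulmxA mul_adj_mx detX mul_scalar_mx.
  by apply/matrixP=> i j; apply: (mulfI p0); have := E i j; rewrite mxE => ->; rewrite mxE.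
have -> : cofactor X k l = (\adj X) l k by rewrite mxE.
rewrite adjE mxE; apply: eq_bigr => i _.
by rewrite mul_mx_diag !mxE mulrAC -polyCM mul_polyC.
Qed.

(** The minimal polynomial divides a product of distinct linear factors. The order of [d] is that of
    the diagonalising basis, so each entry is only identified with some [lam j]. *)
Lemma diagonalize_inj M (lam : 'I_n -> F) :
  char_poly M = \prod_i ('X - (lam i)%:P) -> injective lam ->
  exists V (d : 'I_n -> F), [/\ V \in unitmx,
    M = invmx V *m diag_mx (\row_i d i) *m V & forall i, exists j, d i = lam j].
Proof.
move=> cM li.
have [P uP /(diagonalizable_forLR uP)[D DE]] : diagonalizable M.
  case: n M lam cM li => [|m] M lam cM li.
    by exists 1%:M; rewrite ?unitmx1 //; apply/is_diag_mxP => -[].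
  apply/diagonalizableP; exists [seq lam i | i <- index_enum 'I_m.+1].
    by rewrite map_inj_uniq // index_enum_uniq.
  by rewrite big_map -cM mxminpoly_dvd_char.
exists P, (fun i => D 0 i); rewrite uP.
have DD : diag_mx (\row_i D 0 i) = diag_mx D.
  by congr diag_mx; apply/rowP => i; rewrite mxE.
have ME : M = invmx P *m diag_mx (\row_i D 0 i) *m P by rewrite DD -conjVmx.
split=> // i; have : root (char_poly M) (D 0 i).
  rewrite ME char_poly_conj // char_poly_diag (bigD1 i) //= rootM root_XsubC.
  by rewrite eqxx.
rewrite cM -(big_map lam xpredT (fun z => 'X - z%:P)) root_prod_XsubC.
by case/mapP=> j _ ->; exists j.
Qed.
End CharPoly.

(** * Norms of matrices *)

Section Frobenius.
Local Open Scope complex_scope.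
Variables (R : realType) (n : nat).
Implicit Types (M A E : 'M[R[i]]_n).

Definition fro2 M : R := \sum_i \sum_j normc (M i j) ^+ 2.

Lemma fro2_ge0 M : 0 <= fro2 M.
Proof. by do 2! apply: sumr_ge0 => ? _; rewrite sqr_ge0. Qed.

Lemma normc_le_fro2 M i j : normc (M i j) ^+ 2 <= fro2 M.
Proof.
rewrite /fro2 (bigD1 i) //= (bigD1 j) //= -addrA lerDl addr_ge0 //.
  by apply: sumr_ge0 => ? _; rewrite sqr_ge0.
by do 2! apply: sumr_ge0 => ? _; rewrite sqr_ge0.
Qed.

Lemma fro2_add M E : fro2 (M + E) <= 2 * fro2 M + 2 * fro2 E.
Proof.
rewrite /fro2 !mulr_sumr -big_split; apply: ler_sum => i _ /=.
rewrite !mulr_sumr -big_split; apply: ler_sum => j _ /=; rewrite mxE.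
have : normc (M i j + E i j) ^+ 2 <= (normc (M i j) + normc (E i j)) ^+ 2.
  by rewrite lerXn2r ?normcD // nnegrE ?addr_ge0 ?normc_ge0.
have := sqr_ge0 (normc (M i j) - normc (E i j)).
lra.
Qed.

Lemma fro2_le M (m : R) : (forall i j, normc (M i j) <= m) -> fro2 M <= n%:R * (n%:R * m ^+ 2).
Proof.
move=> Mm; rewrite -[n in n%:R * (_ * _)]card_ord mulr_natl -sumr_const.
apply: ler_sum => i _; rewrite -[n in n%:R * _]card_ord mulr_natl -sumr_const.
apply: ler_sum => j _; have m0 : 0 <= m := le_trans (normc_ge0 _) (Mm i j).
by rewrite lerXn2r ?nnegrE ?normc_ge0.
Qed.

Lemma fro2Z (t : R[i]) M : fro2 (t *: M) = normc t ^+ 2 * fro2 M.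
Proof.
rewrite /fro2 mulr_sumr; apply: eq_bigr => i _; rewrite mulr_sumr.
by apply: eq_bigr => j _; rewrite mxE normcM exprMn.
Qed.

Lemma sum_cross_fro2 M k l (eta : R) :
  \sum_m fro2 (M + cross eta m *: delta_mx k l) = 4 * (fro2 M + eta ^+ 2).
Proof.
pose dl i j : R := ((i == k) && (j == l))%:R.
have dE : \sum_i \sum_j dl i j = 1.
  rewrite (bigD1 k) //= (bigD1 l) //= /dl !eqxx /= !big1 ?addr0 // => [i ik|j jl].
    by rewrite big1 // => j _; rewrite (negbTE ik).
  by rewrite (negbTE jl).
have e2 : eta ^+ 2 = eta ^+ 2 * \sum_i \sum_j dl i j by rewrite dE mulr1.
rewrite /fro2 exchange_big /= [in RHS]e2 mulr_sumr -big_split mulr_sumr.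
apply: eq_bigr => i _; rewrite exchange_big /= mulr_sumr -big_split mulr_sumr.
apply: eq_bigr => j _ /=.
(* Each entry is a quadratic in [cross eta m] with linear coefficient 1 at position [(k, l)] and 0
   elsewhere, so the identity for a single number applies. *)
rewrite (eq_bigr (fun m => normc (M i j + ((i == k) && (j == l))%:R * cross eta m
  + 0 * cross eta m ^+ 2) ^+ 2)) => [|m _].
  rewrite sum_cross_normc_sqr /dl normc0; case: (_ && _); rewrite ?mulr0n ?mulr1n.
    by rewrite normc1; ring.
  by rewrite normc0; ring.
by rewrite !mxE mul0r addr0 mulrC.
Qed.

(** Cauchy-Schwarz against the constant vector 1, read off from the sum of all [(F i - F j)^2]. *)
Lemma sqr_sum_le (F : 'I_n -> R) : (\sum_i F i) ^+ 2 <= n%:R * \sum_i F i ^+ 2.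
Proof.
have : 0 <= \sum_i \sum_j (F i - F j) ^+ 2 by do 2! apply: sumr_ge0 => ? _; rewrite sqr_ge0.
have -> : \sum_i \sum_j (F i - F j) ^+ 2 =
    2 * (n%:R * \sum_i F i ^+ 2 - (\sum_i F i) ^+ 2).
  rewrite (eq_bigr (fun i => n%:R * F i ^+ 2 - 2 * (F i * \sum_j F j) + \sum_j F j ^+ 2)).
    rewrite big_split sumrB /= -!mulr_sumr -mulr_suml sumr_const card_ord -mulr_natl.
    by ring.
  move=> i _; rewrite mulr_sumr [2 * _]mulr_sumr.
  rewrite -[n in n%:R * _]card_ord mulr_natl -sumr_const -sumrB -big_split.
  by apply: eq_bigr => j _ /=; ring.
lra.
Qed.

(** At the largest entry [k] of a left eigenvector, the eigenvalue equation bounds [|z|] by the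
    [l^1] norm of column [k] of [M]; Cauchy-Schwarz does the rest. *)
Lemma char_poly_root_le M z : root (char_poly M) z -> normc z ^+ 2 <= n%:R * fro2 M.
Proof.
rewrite -eigenvalue_root_char => /eigenvalueP[v vM v0].
have /rV0Pn[k0 _] := v0.
case: (@Order.TotalTheory.arg_maxP _ _ _ k0 xpredT (fun k => normc (v 0 k))) => // k _ kmax.
have vk : 0 < normc (v 0 k).
  rewrite normc_gt0; apply: contra v0 => /eqP vk0; apply/eqP/rowP => j.
  have := kmax j isT; rewrite vk0 normc0 mxE => /= h.
  by apply: eq0_normc; apply/eqP; rewrite eq_le h normc_ge0.
have zle : normc z <= \sum_i normc (M i k).
  rewrite -(ler_pM2r vk) -normcM.
  have -> : z * v 0 k = (v *m M) 0 k by rewrite vM mxE.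
  rewrite mxE; apply: le_trans (normc_sum _ _ _) _; rewrite mulr_suml.
  apply: ler_sum => i _; rewrite normcM mulrC ler_wpM2l ?normc_ge0 //; exact: kmax.
apply: le_trans (_ : (\sum_i normc (M i k)) ^+ 2 <= _).
  by rewrite lerXn2r ?nnegrE ?normc_ge0 // sumr_ge0 // => i _; apply: normc_ge0.
apply: le_trans (sqr_sum_le _) _; rewrite ler_wpM2l ?ler0n //.
apply: ler_sum => i _; rewrite (bigD1 k) //= lerDl.
by apply: sumr_ge0 => j _; rewrite sqr_ge0.
Qed.

(* Shift the diagonal of a Schur form by [s * i] for a small [s] outside a finite
   set of bad values. *)
Lemma char_poly_simple_near A (tau : R) : (0 < n)%N -> 0 < tau ->
  exists E (lam : 'I_n -> R[i]), [/\ fro2 E <= tau,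
    char_poly (A + E) = \prod_i ('X - (lam i)%:P) & injective lam].
Proof.
move=> n0 t0.
have [P uP] := @Schur _ _ A n0; have {}uP := unitarymx_unit uP.
rewrite /similar_to mxred.conjumx //; set T := P *m A *m invmx P => Ttrig.
pose D : 'M[R[i]]_n := diag_mx (\row_i (nat_of_ord i)%:R).
pose Q := invmx P *m D *m P.
pose s0 : R := Num.min 1 (tau / (fro2 Q + 1)).
have Q0 := fro2_ge0 Q; have Q1 : 0 < fro2 Q + 1 by lra.
have s00 : 0 < s0 by rewrite lt_min ltr01 divr_gt0.
(* There are [n^2 + 1] distinct candidate shifts and at most [n^2] bad values, so one candidate is
   good. *)
pose s (m : 'I_(n * n).+1) : R := s0 / m.+1%:R.
have s_inj : injective (fun m => (s m)%:C).
  move=> a b /complexI /(mulfI (lt0r_neq0 s00)) /invr_inj /eqP.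
  by rewrite eqr_nat eqSS => /eqP /val_inj.
(* For [i != j] this is the only shift at which the shifted diagonal entries [i] and [j] collide. On
   the diagonal it is [0 / 0 = 0], which is harmless. *)
pose bad (ij : 'I_n * 'I_n) := (T ij.2 ij.2 - T ij.1 ij.1) / (ij.1%:R - ij.2%:R).
have [m mbad] : exists m, (s m)%:C \notin [seq bad ij | ij : 'I_n * 'I_n].
  apply: contrapT => H.
  have sub : {subset [seq (s m)%:C | m : 'I_(n * n).+1] <= [seq bad ij | ij : 'I_n * 'I_n]}.
    move=> z /mapP[m _ ->]; apply: contrapT => /negP h; apply: H; by exists m.
  have := uniq_leq_size _ sub; rewrite map_inj_uniq // enum_uniq => /(_ isT).
  by rewrite !size_image card_prod !card_ord ltnn.
have sm0 : 0 < s m by rewrite divr_gt0.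
have sms0 : s m <= s0 by rewrite ler_pdivrMr ?ltr0n // ler_peMr ?ler1n ?(ltW s00).
exists ((s m)%:C *: Q), (fun i => T i i + (s m)%:C * i%:R); split.
- rewrite fro2Z normc_real; last exact: ltW.
  have h1 : s0 <= 1 by rewrite ge_min lexx.
  have h2 : s0 * (fro2 Q + 1) <= tau by rewrite -ler_pdivlMr // ge_min lexx orbT.
  apply: le_trans h2; rewrite expr2 -mulrA.
  have sF : s m * fro2 Q <= 1 * fro2 Q by apply: ler_wpM2r => //; lra.
  have sF0 : 0 <= s m * fro2 Q by rewrite mulr_ge0 // (ltW sm0).
  have := ler_pM (ltW sm0) sF0 sms0 sF; lra.
- have -> : A + (s m)%:C *: Q = invmx P *m (T + (s m)%:C *: D) *m P.
    rewrite mulmxDr mulmxDl -scalemxAr -scalemxAl /T; congr (_ + _).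
    by rewrite -!mulmxA mulVmx // mulmx1 mulKmx.
  rewrite char_poly_conj // char_poly_trig; last first.
    have /is_trig_mxP Tt := Ttrig.
    apply/is_trig_mxP => i j ij; rewrite mxE Tt // add0r !mxE.
    by rewrite -val_eqE /= ltn_eqF // mulr0n mulr0.
  by apply: eq_bigr => i _; rewrite !mxE eqxx mulr1n.
move=> i j e; apply: contrapT => /eqP ij.
apply/negP: mbad; rewrite negbK; apply/mapP; exists (i, j); rewrite ?mem_enum //= /bad /=.
have d0 : (i : nat)%:R - (j : nat)%:R != 0 :> R[i] by rewrite subr_eq0 eqr_nat.
apply: (mulIf d0); rewrite divfK //.
have -> : (s m)%:C * ((i : nat)%:R - (j : nat)%:R) =
    (T i i + (s m)%:C * (i : nat)%:R) - T i i - (s m)%:C * (j : nat)%:R by ring.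
by rewrite e; ring.
Qed.
End Frobenius.

(** * Operator norm and eigenvector condition number *)

Section OperatorNorm.
Local Open Scope complex_scope.
Variables (R : realType) (n : nat).
Implicit Types (M A : 'M[R[i]]_n) (x : 'cV[R[i]]_n).
Lemma normc_le_l2norm x i : normc (x i 0) <= l2norm x.
Proof.
rewrite /l2norm -[leLHS]ger0_norm ?normc_ge0 // -sqrtr_sqr ler_wsqrtr //.
by rewrite (bigD1 i) //= lerDl sumr_ge0 // => j _; rewrite sqr_ge0.
Qed.

Lemma l2norm_mulmx_le M x (m : R) : 0 <= m -> (forall i j, normc (M i j) <= m) ->
  l2norm x <= 1 -> l2norm (M *m x) <= n%:R ^+ 2 * m.
Proof.
move=> m0 Mm x1.
have nm0 : 0 <= n%:R ^+ 2 * m by rewrite mulr_ge0 // exprn_ge0.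
rewrite /l2norm -[leRHS]ger0_norm // -sqrtr_sqr ler_wsqrtr //.
have Mx i : normc ((M *m x) i 0) <= n%:R * m.
  rewrite mxE; apply: le_trans (normc_sum _ _ _) _.
  rewrite -[n in n%:R * _]card_ord mulr_natl -sumr_const; apply: ler_sum => j _.
  rewrite -[leRHS]mulr1; apply: ler_normcM => //.
  exact: le_trans (normc_le_l2norm _ _) x1.
apply: le_trans (_ : \sum_(i < n) (n%:R * m) ^+ 2 <= _).
  by apply: ler_sum => i _; rewrite lerXn2r ?nnegrE ?normc_ge0 ?mulr_ge0.
rewrite sumr_const card_ord -[(_ ^+ 2) *+ n]mulr_natl.
have -> : (n%:R ^+ 2 * m) ^+ 2 = n%:R * (n%:R * m) ^+ 2 * n%:R :> R by ring.
case: (n) => [|k]; first by rewrite !mul0r.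
by rewrite ler_peMr ?ler1n // mulr_ge0 // exprn_ge0 // mulr_ge0.
Qed.

Lemma l2norm0 : l2norm (0 : 'cV[R[i]]_n) = 0.
Proof. by rewrite /l2norm big1 ?sqrtr0 // => i _; rewrite mxE normc0 expr0n. Qed.

Lemma opnorm_le M (m : R) : 0 <= m -> (forall i j, normc (M i j) <= m) ->
  opnorm M <= n%:R ^+ 2 * m.
Proof.
move=> m0 Mm; apply: ge_sup => [|_ [x /= x1 <-]]; last exact: l2norm_mulmx_le.
by exists (l2norm (M *m 0)), 0 => //=; rewrite l2norm0.
Qed.

Lemma normc_le_opnorm A i j : normc (A i j) <= opnorm A.
Proof.
have -> : A i j = (A *m (delta_mx j 0 : 'cV_n)) i 0 by rewrite -colE mxE.
apply: le_trans (normc_le_l2norm _ _) _; apply: ub_le_sup; last first.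
  exists (delta_mx j 0) => //=; rewrite /l2norm -[leRHS]sqrtr1 ler_wsqrtr //.
  rewrite (bigD1 j) //= big1 ?addr0 => [|k kj].
    by rewrite mxE !eqxx normc1 expr1n.
  by rewrite mxE (negbTE kj) normc0 expr0n.
exists (n%:R ^+ 2 * (\sum_a \sum_b normc (A a b))) => _ [x /= x1 <-].
apply: l2norm_mulmx_le => // [|a b].
  by do 2! apply: sumr_ge0 => ? _; apply: normc_ge0.
rewrite (bigD1 a) //= (bigD1 b) //= -addrA lerDl addr_ge0 //.
  by apply: sumr_ge0 => ? _; apply: normc_ge0.
by do 2! apply: sumr_ge0 => ? _; apply: normc_ge0.
Qed.

Lemma opnorm_ge0 M : (0 < n)%N -> 0 <= opnorm M.
Proof.
move=> n0; apply: le_trans (normc_le_opnorm M (Ordinal n0) (Ordinal n0)).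
exact: normc_ge0.
Qed.

(** The products [invmx P l i * P i k] are the entries of the spectral projections and do not change
    when eigenvectors are rescaled. After normalisation the entries of [V] are at most 1 and those
    of its inverse at most [n K]; each operator norm costs a further [n^2]. *)
Lemma kappaV_le M P (d : 'I_n -> R[i]) (K : R) : (0 < n)%N -> 0 <= K -> P \in unitmx ->
  M = invmx P *m diag_mx (\row_i d i) *m P ->
  (forall l i k, normc (invmx P l i * P i k) <= K) ->
  (kappaV M <= (n%:R ^+ 5 * K)%:E)%E.
Proof.
move=> n0 K0 uP ME PK.
(* The columns of [invmx P] are eigenvectors; normalise them in [l^1]. *)
pose s i := \sum_l normc (invmx P l i).
have s0 i : 0 < s i.
  rewrite lt_def sumr_ge0 ?andbT => [|l _]; last exact: normc_ge0.
  apply/eqP => si0.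
  have col0 l : invmx P l i = 0.
    apply: eq0_normc; apply/eqP; rewrite eq_le normc_ge0 andbT.
    rewrite -si0 /s (bigD1 l) //= lerDl sumr_ge0 // => k _; exact: normc_ge0.
  have : (P *m invmx P) i i = 1 by rewrite mulmxV // mxE eqxx.
  rewrite mxE big1 => [/eqP|l _]; first by rewrite eq_sym oner_eq0.
  by rewrite col0 mulr0.
pose S := diag_mx (\row_i (s i)%:C); pose S' := diag_mx (\row_i ((s i)%:C)^-1).
have sC i : (s i)%:C != 0 by rewrite -normc_gt0 normc_real // ltW.
have SS' : S *m S' = 1%:M.
  rewrite mulmx_diag; apply/matrixP=> i j; rewrite !mxE; case: eqP => //= _.
  by rewrite divff.
have S'S : S' *m S = 1%:M by exact: mulmx1C.
pose V := invmx P *m S'; pose W := S *m P.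
have WV : W *m V = 1%:M by rewrite /W /V mulmxA -[S *m P *m _]mulmxA mulmxV // mulmx1.
have [uW uV] := mulmx1_unit WV.
have VE : invmx V = W by rewrite -[LHS]mul1mx -WV mulmxK.
have V1 l i : normc (V l i) <= 1.
  rewrite /V mul_mx_diag !mxE normcM normcV (normc_real (ltW (s0 i))).
  rewrite ler_pdivrMr // mul1r /s (bigD1 l) //= lerDl.
  by apply: sumr_ge0 => k _; apply: normc_ge0.
have W1 i k : normc (W i k) <= n%:R * K.
  rewrite /W mul_diag_mx !mxE normcM (normc_real (ltW (s0 i))) mulr_suml.
  rewrite -[n in n%:R * _]card_ord mulr_natl -sumr_const; apply: ler_sum => l _.
  by rewrite -normcM.
apply: ge_ereal_inf; exists ((opnorm V * opnorm (invmx V))%:E).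
  exists V => //; split=> //; exists (diag_mx (\row_i d i)); split.
    exact: diag_mx_is_diag.
  rewrite VE /V /W ME !mulmxA; congr (_ *m _).
  rewrite -!mulmxA; congr (_ *m _).
  by rewrite diag_mxC mulmxA S'S mul1mx.
rewrite lee_fin VE.
have -> : n%:R ^+ 5 * K = (n%:R ^+ 2 * 1) * (n%:R ^+ 2 * (n%:R * K)) :> R by ring.
apply: ler_pM; rewrite ?opnorm_ge0 //; apply: opnorm_le => //.
by rewrite mulr_ge0.
Qed.
End OperatorNorm.

(** * The energy and its near maxima *)

Section Energy.
Variables (R : realType) (n : nat).
Implicit Types (M A E : 'M[R[i]]_n) (lam : 'I_n -> R[i]) (c h : R).

Definition splits_simply M lam : Prop :=
  char_poly M = \prod_i ('X - (lam i)%:P) /\ injective lam.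

(** The logarithm of the modulus of the discriminant; each unordered pair counts twice. *)
Definition log_gaps lam : R := \sum_i \sum_(j | j != i) ln (normc (lam i - lam j)).

(** The eigenvalues are passed as an argument, so no enumeration has to be chosen; the value does
    not depend on their order. *)
Definition energy c h A M lam : R :=
  \sum_i normc (lam i) ^+ 2 - c * fro2 (M - A) + h * log_gaps lam.

(* The derivative at [t = 0] of the eigenvalue [lam i] of [M + t *: delta_mx k l]. *)
Definition eigen_deriv M lam k l i : R[i] :=
  (cofactor (char_poly_mx M) k l).[lam i] / (char_poly M)^`().[lam i].

Lemma size_char_poly_sub M E : (size (char_poly M - char_poly E)%R <= n)%N.
Proof.
apply/leq_sizeP => j; rewrite leq_eqVlt coefB => /orP[/eqP <-|nj].
  have cn (X : 'M[R[i]]_n) : (char_poly X)`_n = 1.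
    by have /monicP := char_poly_monic X; rewrite lead_coefE size_char_poly.
  by rewrite !cn subrr.
by rewrite !nth_default ?subrr // size_char_poly.
Qed.

(** Every root satisfies [|z|^2 <= n B], hence [|z| <= 1 + n B]; the other 1 comes from
    [coef_prod_XsubC_le]. *)
Lemma coef_char_poly_le M (B : R) k : 0 <= B -> fro2 M <= B ->
  normc (char_poly M)`_k <= (2 + n%:R * B) ^+ n.
Proof.
move=> B0 MB; have [rs pE sE] := monic_prod_roots (char_poly_monic M).
have srs : size rs = n by have := size_char_poly M; rewrite sE => -[].
rewrite [in X in X <= _]pE -{2}srs -[2 + _]addrA.
have nB : 0 <= n%:R * B by rewrite mulr_ge0.
apply: coef_prod_XsubC_le => [|z zin]; first by rewrite addr_ge0.
have /char_poly_root_le zM : root (char_poly M) z by rewrite pE root_prod_XsubC.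
have : n%:R * fro2 M <= n%:R * B by rewrite ler_wpM2l.
have := normc_ge0 z; nra.
Qed.

(** Up to cubic errors, the squared eigenvalues gain their squared derivatives, the penalty loses
    exactly [c eta^2] on average, and the barrier loses nothing. [C] and [e] do not depend on [M] or
    [lam], so they can be fixed before a near maximum is chosen. *)
Lemma energy_cross_ge (B g c h : R) A : 0 <= B -> 0 < g -> 0 <= h ->
  exists C e : R, [/\ 0 < e, e <= 1 & forall M lam k l (eta : R),
    splits_simply M lam -> (forall i, normc (lam i) <= B) -> fro2 M <= B ->
    (forall i j, i != j -> g <= normc (lam i - lam j)) -> 0 < eta <= e ->
    exists mu : 'I_4 -> 'I_n -> R[i],
      (forall m, splits_simply (M + cross eta m *: delta_mx k l) (mu m)) /\
      4 * energy c h A M lam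
        + 4 * eta ^+ 2 * (\sum_i normc (eigen_deriv M lam k l i) ^+ 2 - c)
        - C * eta ^+ 3
      <= \sum_m energy c h A (M + cross eta m *: delta_mx k l) (mu m)].
Proof.
move=> B0 g0 h0.
pose K := (2 + n%:R * B) ^+ n + (2 + n%:R * (2 * B + 2)) ^+ n.
have [L [e1 [L1 e10 e11 HL]]] := roots_expansion n K B0 g0.
have L0 : 0 <= L by lra.
have LL0 : 0 <= 2 * L by lra.
have [C1 HC1] := sum_cross_normc_sqr_ge L0 B0.
have [C2 [e2 [e20 e21 HC2]]] := sum_cross_ln_ge LL0 g0.
exists (\sum_(i < n) C1 + h * (\sum_(i < n) \sum_(j < n | j != i) C2)), (Num.min e1 e2); split.
- by rewrite lt_min e10.
- by rewrite ge_min e11.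
move=> M lam k l eta [pM lam_inj] lamB MB gap /andP[eta0].
rewrite le_min => /andP[ee1 ee2].
have eta1 : eta <= 1 by lra.
set q := cofactor (char_poly_mx M) k l.
(* As a difference of two characteristic polynomials, [q] has degree below [n] and coefficients
   bounded by [K]. *)
have qE : q = char_poly M - char_poly (M + delta_mx k l).
  have := char_poly_add_delta M 1 k l; rewrite !scale1r -/q => ->.
  by rewrite subKr.
have MdB : fro2 (M + delta_mx k l) <= 2 * B + 2.
  apply: le_trans (fro2_add _ _) _.
  have : fro2 (delta_mx k l : 'M[R[i]]_n) <= 1.
    rewrite /fro2 (bigD1 k) //= (bigD1 l) //= !big1 ?addr0 => [|i ik|j jl].
    - by rewrite mxE !eqxx normc1 expr1n.
    - by rewrite big1 // => j _; rewrite mxE (negbTE ik) normc0 expr0n.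
    - by rewrite mxE (negbTE jl) andbF normc0 expr0n.
  lra.
have qK m : normc q`_m <= K.
  rewrite qE coefB; apply: le_trans (normcB_le _ _) _; apply: lerD.
    exact: coef_char_poly_le.
  by apply: coef_char_poly_le => //; lra.
have sq : (size q <= n)%N by rewrite qE size_char_poly_sub.
have /= := HL lam q sq qK lamB gap; rewrite -pM => -[b [aL bL Hb]].
set a := fun i => q.[lam i] / (char_poly M)^`().[lam i] in aL Hb.
have tm m : normc (cross eta m) = eta by rewrite normc_cross // ltW.
have Hm m : exists mu : 'I_n -> R[i], [/\ injective mu,
    char_poly M - cross eta m *: q = \prod_i ('X - (mu i)%:P) & forall i,
    normc (mu i - (lam i + a i * cross eta m + b i * cross eta m ^+ 2)) <= L * eta ^+ 3].
  by have := Hb (cross eta m); rewrite tm eta0 ee1 => /(_ isT).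
have [mu Hmu] := fin_all_exists Hm.
exists mu; split=> [m|].
  by have [mi mE _] := Hmu m; split=> //; rewrite char_poly_add_delta.
have sumsq : 4 * \sum_i normc (lam i) ^+ 2 + 4 * eta ^+ 2 * \sum_i normc (a i) ^+ 2
    - (\sum_(i < n) C1) * eta ^+ 3 <= \sum_m \sum_i normc (mu m i) ^+ 2.
  rewrite exchange_big /= !mulr_sumr mulr_suml -big_split -sumrB /=.
  apply: ler_sum => i _; rewrite -mulrA -mulrDr.
  apply: (HC1 _ _ (b i)) => //; [exact: aL|by rewrite eta0|].
  by move=> m; have [_ _] := Hmu m.
have sumfro : \sum_m fro2 (M + cross eta m *: delta_mx k l - A) =
    4 * (fro2 (M - A) + eta ^+ 2).
  by rewrite -(sum_cross_fro2 _ k l); apply: eq_bigr => m _; rewrite addrAC.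
have sumln : 4 * log_gaps lam - (\sum_(i < n) \sum_(j < n | j != i) C2) * eta ^+ 3
    <= \sum_m log_gaps (mu m).
  rewrite [leRHS]exchange_big /= mulr_sumr mulr_suml -sumrB; apply: ler_sum => i _.
  rewrite exchange_big /= mulr_sumr mulr_suml -sumrB; apply: ler_sum => j ji.
  apply: (HC2 _ (a i - a j) (b i - b j)).
  - by rewrite gap // eq_sym.
  - by apply: le_trans (normcB_le _ _) _; have := aL i; have := aL j; lra.
  - by apply: le_trans (normcB_le _ _) _; have := bL i; have := bL j; lra.
  - by rewrite eta0.
  move=> m; have [_ _ mL] := Hmu m.
  have -> : mu m i - mu m j - (lam i - lam j + (a i - a j) * cross eta m +
      (b i - b j) * cross eta m ^+ 2) =
    (mu m i - (lam i + a i * cross eta m + b i * cross eta m ^+ 2)) -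
    (mu m j - (lam j + a j * cross eta m + b j * cross eta m ^+ 2)) by ring.
  by apply: le_trans (normcB_le _ _) _; have := mL i; have := mL j; lra.
rewrite /energy big_split sumrB /= -!mulr_sumr sumfro.
have := ler_wpM2l h0 sumln.
have -> : \sum_i normc (eigen_deriv M lam k l i) ^+ 2 = \sum_i normc (a i) ^+ 2 by [].
move: sumsq.
set X1 := \sum_i normc (lam i) ^+ 2; set X2 := \sum_i normc (a i) ^+ 2.
set X3 := \sum_m \sum_i _; set X4 := \sum_m log_gaps _.
lra.
Qed.
End Energy.

(** * Choice and properties of a near maximum *)

Section Maximum.
Variables (R : realType) (n : nat).
Implicit Types (M A E : 'M[R[i]]_n) (lam : 'I_n -> R[i]) (c h : R).

Lemma log_gap_le lam i j : injective lam -> i != j ->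
  ln (normc (lam i - lam j)) <= 1 + \sum_k normc (lam k) ^+ 2.
Proof.
move=> li ij.
have pos : 0 < normc (lam i - lam j) by rewrite normc_gt0 subr_eq0 (inj_eq li).
apply: le_trans (ltW (ln_sublinear pos)) _.
apply: le_trans (normcB_le _ _) _.
rewrite (bigD1 i) //= (bigD1 j) 1?eq_sym //= addrA.
have : 0 <= \sum_(k | (k != i) && (k != j)) normc (lam k) ^+ 2.
  by apply: sumr_ge0 => k _; rewrite sqr_ge0.
have := sqr_ge0 (normc (lam i) - 1); have := sqr_ge0 (normc (lam j) - 1).
have := sqr_ge0 (normc (lam i)); have := sqr_ge0 (normc (lam j)).
lra.
Qed.

(** Bounding all terms but one from above lets a lower bound on the energy become a lower bound on
    each single gap. *)
Lemma log_gaps_le_pair lam i j : injective lam -> i != j ->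
  log_gaps lam <= n%:R ^+ 2 * (1 + \sum_k normc (lam k) ^+ 2)
    + ln (normc (lam i - lam j)).
Proof.
move=> li ij; set X := 1 + _.
have X0 : 0 <= X by rewrite addr_ge0 // sumr_ge0 // => k _; rewrite sqr_ge0.
pose F k l := if (l != k) && ((k, l) != (i, j)) then ln (normc (lam k - lam l)) else 0.
have FX k l : F k l <= X.
  by rewrite /F; case: ifP => // /andP[lk _]; rewrite log_gap_le // eq_sym.
have -> : log_gaps lam = \sum_k \sum_l F k l + ln (normc (lam i - lam j)).
  rewrite /log_gaps (bigD1 i) //= (bigD1 j) 1?eq_sym //= [in RHS](bigD1 i) //=.
  rewrite addrC addrA addrAC; congr (_ + _); rewrite addrC; congr (_ + _).
    rewrite big_mkcond /=; apply: eq_bigr => l _; rewrite /F xpair_eqE eqxx /=.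
    by [].
  apply: eq_bigr => k ki; rewrite big_mkcond /=; apply: eq_bigr => l _.
  by rewrite /F xpair_eqE (negbTE ki) andbT.
rewrite lerD2r expr2 -mulrA -[n in n%:R * _]card_ord mulr_natl -sumr_const.
apply: ler_sum => k _.
by rewrite -[n in n%:R * _]card_ord mulr_natl -sumr_const; apply: ler_sum.
Qed.

Lemma log_gaps_le lam : injective lam ->
  log_gaps lam <= n%:R ^+ 2 * (1 + \sum_k normc (lam k) ^+ 2).
Proof.
move=> li; set X := 1 + _.
have X0 : 0 <= X by rewrite addr_ge0 // sumr_ge0 // => k _; rewrite sqr_ge0.
rewrite expr2 -mulrA -[n in n%:R * _]card_ord mulr_natl -sumr_const.
apply: ler_sum => k _; rewrite -[n in n%:R * _]card_ord mulr_natl -sumr_const.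
rewrite big_mkcond; apply: ler_sum => l _; case: ifP => // lk.
by rewrite log_gap_le // eq_sym.
Qed.

Lemma eigenvalues_sqr_le M lam : splits_simply M lam ->
  \sum_i normc (lam i) ^+ 2 <= n%:R ^+ 2 * fro2 M.
Proof.
move=> [pM _]; rewrite expr2 -mulrA -[n in n%:R * _]card_ord mulr_natl -sumr_const.
apply: ler_sum => i _; apply: char_poly_root_le.
by rewrite pM (bigD1 i) //= rootM root_XsubC eqxx.
Qed.

Lemma near_maximum A c : (0 < n)%N -> 8 * n%:R ^+ 2 <= c ->
  exists M lam, [/\ splits_simply M lam,
    fro2 (M - A) <= (8 * n%:R ^+ 2 * fro2 A + 8) / c &
    forall k l i, normc (eigen_deriv M lam k l i) ^+ 2 <= c + 1].
Proof.
move=> n0 nc; set D := n%:R ^+ 2 in nc *.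
have D1 : 1 <= D by rewrite exprn_ege1 // ler1n.
have c0 : 0 < c by lra.
have [E0 [lam0 [E0c pE0 lam0i]]] : exists E lam, [/\ fro2 E <= c^-1,
    char_poly (A + E) = \prod_i ('X - (lam i)%:P) & injective lam].
  by apply: char_poly_simple_near; rewrite ?invr_gt0.
(* This [h] gives [h D <= 1], so the barrier adds at most [1 + Phi lam], and
   [h |log_gaps lam0| <= 1], so it costs little at the starting point. *)
pose h := (D + 1 + `|log_gaps lam0|)^-1.
have a0 := normr_ge0 (log_gaps lam0).
have dh : 0 < D + 1 + `|log_gaps lam0| by lra.
have h0 : 0 < h by rewrite invr_gt0.
have hh : h * (D + 1 + `|log_gaps lam0|) = 1 by rewrite mulVf ?gt_eqF.
have hD : h * D <= 1 by nra.
have hl0 : -1 <= h * log_gaps lam0.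
  have : - `|log_gaps lam0| <= log_gaps lam0.
    by have := ler_norm (- log_gaps lam0); rewrite normrN; lra.
  nra.
have FA := fro2_ge0 A.
pose Phi lam : R := \sum_i normc (lam i) ^+ 2.
have Phi0 lam : 0 <= Phi lam by apply: sumr_ge0 => i _; rewrite sqr_ge0.
have PhiM M lam : splits_simply M lam -> Phi lam <= 2 * D * fro2 (M - A) + 2 * D * fro2 A.
  move=> sM; apply: le_trans (eigenvalues_sqr_le sM) _; rewrite -/D.
  have := fro2_add (M - A) A; rewrite subrK => h1.
  have := ler_wpM2l (ltW (lt_le_trans ltr01 D1)) h1; lra.
(* Squared eigenvalues and barrier together are at most [1 + 2 Phi lam]; since [8 D <= c], half of
   the penalty absorbs the part that grows with [M - A]. *)
have energy_le M lam : splits_simply M lam ->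
    energy c h A M lam <= 4 * D * fro2 A + 1 - c / 2 * fro2 (M - A).
  move=> sM; have P1 := PhiM _ _ sM; have [_ li] := sM.
  have := log_gaps_le li; rewrite -/D -/(Phi lam) => h1.
  have := ler_wpM2l (ltW h0) h1; rewrite mulrA => h2.
  have h3 : h * D * (1 + Phi lam) <= 1 * (1 + Phi lam).
    by apply: ler_wpM2r => //; have := Phi0 lam; lra.
  have : 8 * D * fro2 (M - A) <= c * fro2 (M - A) by rewrite ler_wpM2r ?fro2_ge0.
  rewrite /energy -/(Phi lam); lra.
have energy0 : -2 <= energy c h A (A + E0) lam0.
  rewrite /energy [A + E0 - A]addrAC subrr add0r -/(Phi lam0).
  have : c * fro2 E0 <= c * c^-1 by rewrite ler_wpM2l // ltW.
  rewrite divff ?gt_eqF //; have := Phi0 lam0; lra.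
pose S : set R := [set x | exists M lam, splits_simply M lam /\ x = energy c h A M lam]%classic.
have S0 : S (energy c h A (A + E0) lam0) by exists (A + E0), lam0.
have Sub : has_ubound S.
  exists (4 * D * fro2 A + 1) => _ [M [lam [sM ->]]].
  have := energy_le _ _ sM; have := fro2_ge0 (M - A); nra.
have Ssup : has_sup S by split=> //; exists (energy c h A (A + E0) lam0).
have s0 : -2 <= sup S by apply: le_trans energy0 _; apply: ub_le_sup.
have fro_le M lam : splits_simply M lam -> -3 <= energy c h A M lam ->
    fro2 (M - A) <= (8 * D * fro2 A + 8) / c.
  move=> sM e3; rewrite ler_pdivlMr //; have := energy_le _ _ sM; lra.
pose Bf := (8 * D * fro2 A + 8) / c.
have Bf0 : 0 <= Bf by rewrite divr_ge0 ?(ltW c0) //; have := mulr_ge0 (le_trans ler01 D1) FA; lra.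
pose P := 2 * D * Bf + 2 * D * fro2 A.
have P0 : 0 <= P by rewrite addr_ge0 // mulr_ge0 // mulr_ge0 //; lra.
pose B := 1 + P + 2 * Bf + 2 * fro2 A.
(* With energy at least [-3], squared eigenvalues at most [P] and the other barrier terms at most
   [1 + P], each gap satisfies [h ln gap >= -4 - 2 P]. *)
pose g := expR ((- 4 - 2 * P) / h).
have B0 : 0 <= B by rewrite /B; lra.
have [C [e [e0 e1 HC]]] := energy_cross_ge c A B0 (expR_gt0 _ : 0 < g) (ltW h0).
have C0 := normr_ge0 C.
(* Being [eta^3]-close to the supremum costs no more than the cubic error:
   [4 (T - c) <= (4 + C) eta <= 4], whence [T <= c + 1]. *)
pose eta := Num.min e (4 / (4 + `|C|)).
have eta0 : 0 < eta by rewrite lt_min e0 divr_gt0 //; lra.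
have etae : eta <= e by rewrite ge_min lexx.
have etaC : eta * (4 + `|C|) <= 4 by rewrite -ler_pdivlMr ?ge_min ?lexx ?orbT //; lra.
have eta30 : 0 < eta ^+ 3 by rewrite exprn_gt0.
have [_ [M [lam [sM ->]]] Mmax] := sup_adherent eta30 Ssup.
have eta31 : eta ^+ 3 <= 1 by rewrite exprn_ile1 //; lra.
have eM : -3 <= energy c h A M lam by lra.
have fM := fro_le _ _ sM eM.
exists M, lam; split=> // k l.
have PhiP : Phi lam <= P.
  apply: le_trans (PhiM _ _ sM) _; rewrite lerD2r ler_wpM2l //; lra.
have lamB i : normc (lam i) <= B.
  have : normc (lam i) ^+ 2 <= Phi lam.
    by rewrite /Phi (bigD1 i) //= lerDl sumr_ge0 // => j _; rewrite sqr_ge0.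
  by have := sqr_ge0 (normc (lam i) - 1); rewrite /B; have := normc_ge0 (lam i); lra.
have MB : fro2 M <= B.
  have := fro2_add (M - A) A; rewrite subrK /B; move: fM; rewrite -/Bf; lra.
have gapM i j : i != j -> g <= normc (lam i - lam j).
  move=> ij; have [_ li] := sM.
  have pos : 0 < normc (lam i - lam j) by rewrite normc_gt0 subr_eq0 (inj_eq li).
  rewrite /g -[leRHS]lnK ?posrE // ler_expR ler_pdivrMr // mulrC.
  have := log_gaps_le_pair li ij; rewrite -/D -/(Phi lam) => h1.
  have := ler_wpM2l (ltW h0) h1; rewrite mulrDr mulrA => h2.
  have h3 : h * D * (1 + Phi lam) <= 1 * (1 + Phi lam).
    by apply: ler_wpM2r => //; have := Phi0 lam; lra.
  have : 0 <= c * fro2 (M - A) by rewrite mulr_ge0 ?fro2_ge0 // ltW.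
  move: eM; rewrite /energy -/(Phi lam); lra.
have [|mu [smu le_mu]] := HC M lam k l eta sM lamB MB gapM; first by rewrite eta0.
have sum_le : \sum_m energy c h A (M + cross eta m *: delta_mx k l) (mu m) <= 4 * sup S.
  have -> : 4 * sup S = \sum_(m < 4) sup S by rewrite sumr_const card_ord mulr_natl.
  apply: ler_sum => m _.
  by apply: ub_le_sup => //; exists (M + cross eta m *: delta_mx k l), (mu m).
have etaC' : C * eta <= `|C| * eta by rewrite ler_wpM2r ?ler_norm // ltW.
set T := \sum_i normc (eigen_deriv M lam k l i) ^+ 2 in le_mu.
have T1 : T <= c + 1.
  have e20 : 0 < eta ^+ 2 by rewrite exprn_gt0.
  have : 4 * eta ^+ 2 * (T - c) <= (4 + C) * eta ^+ 3 by lra.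
  rewrite (_ : eta ^+ 3 = eta * eta ^+ 2) ?exprS // => le.
  have : 4 * (T - c) <= (4 + C) * eta by rewrite -(ler_pM2r e20); lra.
  lra.
move=> i; apply: le_trans T1.
by rewrite /T (bigD1 i) //= lerDl sumr_ge0 // => j _; rewrite sqr_ge0.
Qed.
End Maximum.

(** * From the near maximum to the perturbation bound *)

Theorem mainTheorem2 (R : realType) (n : nat) (hn : (0 < n)%N) :
  exists c : R, forall (A : 'M[R[i]]_n) (eps : R),
    opnorm A <= 1 -> 0 < eps < 1 ->
    (ereal_inf [set kappaV (A + E) * eps%:E + (opnorm E)%:E
                | E in [set: 'M[R[i]]_n]]
     <= (c * Num.sqrt eps)%:E)%E.
Proof.
pose N : R := n%:R; have N1 : 1 <= N by rewrite ler1n.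
have N21 : 1 <= N ^+ 2 by rewrite exprn_ege1.
exists (3 * N ^+ 6 + 2 * N ^+ 3) => A eps A1 /andP[e0 e1].
set s := Num.sqrt eps; have s0 : 0 < s by rewrite sqrtr_gt0.
have ss : s ^+ 2 = eps by rewrite sqr_sqrtr // ltW.
(* The scale [1 / eps] balances the two terms: [fro2 (M - A)] becomes of order [eps], and eigenvalue
   derivatives of order [1 / s]. *)
pose c := 8 * N ^+ 2 / eps.
have c0 : 0 < c by rewrite divr_gt0 //; lra.
have ce : c * eps = 8 * N ^+ 2 by rewrite divfK // gt_eqF.
have nc : 8 * N ^+ 2 <= c by rewrite -ce ler_piMr ?ltW.
have [M [lam [[pM lam_inj] MA aM]]] := near_maximum A hn nc.
have FA : fro2 A <= N ^+ 2.
  have := @fro2_le _ _ A 1 (fun i j => le_trans (normc_le_opnorm A i j) A1).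
  by rewrite expr1n mulr1 -/N.
have fE i j : normc ((M - A) i j) <= 2 * N * s.
  have Ns : 0 <= 2 * N * s by rewrite mulr_ge0 ?(ltW s0) //; lra.
  rewrite -(@ler_pXn2r _ 2) ?nnegrE ?normc_ge0 //.
  apply: le_trans (normc_le_fro2 _ _ _) _; apply: le_trans MA _.
  rewrite ler_pdivrMr // -/N.
  have -> : (2 * N * s) ^+ 2 * c = 4 * N ^+ 2 * (c * s ^+ 2) by ring.
  rewrite ss ce.
  have := ler_wpM2l (le_trans ler01 N21) FA.
  have := ler_pM ler01 ler01 N21 N21; lra.
have opE : opnorm (M - A) <= 2 * N ^+ 3 * s.
  have := @opnorm_le _ _ (M - A) (2 * N * s) _ fE; rewrite -/N => h.
  have -> : 2 * N ^+ 3 * s = N ^+ 2 * (2 * N * s) by ring.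
  by apply: h; rewrite mulr_ge0 ?(ltW s0) //; lra.
have [P [d [uP ME dlam]]] := diagonalize_inj pM lam_inj.
(* Indeed [c + 1 = (8 N^2 + eps) / eps <= 9 N^2 / eps = K^2]. *)
pose K := 3 * N / s.
have K0 : 0 <= K by rewrite divr_ge0 ?(ltW s0) //; lra.
have Ks : K * s = 3 * N by rewrite divfK // gt_eqF.
have PK l i k : normc (invmx P l i * P i k) <= K.
  have [j dj] := dlam i.
  (* At [d i] only the [i]-th summand of the cofactor survives; its product of differences is
     [p'(d i)], which cancels. *)
  have -> : invmx P l i * P i k = eigen_deriv M lam k l j.
    have pn0 : (char_poly M)^`().[lam j] != 0.
      rewrite pM deriv_prod_XsubC_root; apply/prodf_neq0 => m mj.
      by rewrite subr_eq0 (inj_eq lam_inj) eq_sym.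
    apply: (mulIf pn0); rewrite /eigen_deriv divfK // -dj.
    rewrite {2}ME cofactor_char_poly_diag // {1}ME char_poly_conj // char_poly_diag.
    rewrite deriv_prod_XsubC_root horner_sum [in RHS](bigD1 i) //=.
    rewrite [X in _ = _ + X]big1 ?addr0 => [|m mi].
      rewrite hornerZ horner_prod; congr (_ * _).
      by apply: eq_bigr => m _; rewrite hornerXsubC.
    rewrite hornerZ horner_prod (bigD1 i) 1?eq_sym //= hornerXsubC subrr mul0r.
    by rewrite mulr0.
  rewrite -(@ler_pXn2r _ 2) ?nnegrE ?normc_ge0 //.
  apply: le_trans (aM k l j) _; rewrite expr_div_n ss ler_pdivlMr //.
  by rewrite mulrDl ce exprMn; lra.
have kap := kappaV_le hn K0 uP ME PK.
apply: ge_ereal_inf.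
exists (kappaV (A + (M - A)) * eps%:E + (opnorm (M - A))%:E)%E.
  by exists (M - A).
rewrite [A + (M - A)]addrC subrK.
apply: le_trans (_ : (n%:R ^+ 5 * K)%:E * eps%:E + (2 * N ^+ 3 * s)%:E <= _)%E.
  by apply: leeD; rewrite ?lee_fin //; apply: lee_wpmul2r; rewrite ?lee_fin // ltW.
rewrite -EFinM -EFinD lee_fin -/N -ss mulrDl.
have -> : N ^+ 5 * K * s ^+ 2 = N ^+ 5 * (K * s) * s by ring.
rewrite Ks; lra.
Qed.
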